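(* Let $d\ge3$ and consider the spherical prior $\mathcal X_{\mathrm{sph}}$ (the spike $x$ is uniform on the unit sphere of $\mathbb R^n$). Let $\lambda^*_{\mathrm{sph},d}$ be the supremum of all values $\lambda^*$ for which $$\frac{(\lambda^* )^2}{2}\frac{t^d}{1+t^d}\le-\frac12\log(1-t^2)\qquad\forall t\in[0,1).$$ Then weak detection and weak recovery are impossible for $\mathrm{WT}(d,\lambda,\mathcal X_{\mathrm{sph}})$ for all $\lambda<\lambda^*_{\mathrm{sph},d}$.
   Context: Wigner tensor: for integers $d\ge2$, $n\ge1$, $\mathrm{WT}(d)=\mathrm{WT}_n(d)$ is the law of the symmetric tensor $W\in(\mathbb R^n)^{\otimes d}$ obtained by drawing $W'\in\mathbb R^{n^d}$ with i.i.d. $\mathcal N(0,2/n)$ entries and averaging it over all $d!$ permutations of the indices. Spiked model: for a family $\mathcal X=\{\mathcal X_n\}$ of distributions on unit vectors of $\mathbb R^n$ and $\lambda\ge0$ (not depending on $n$), $\mathrm{WT}(d,\lambda,\mathcal X)$ is the law of $T=\lambda x^{\otimes d}+W$ with $x\sim\mathcal X_n$ and $W\sim\mathrm{WT}_n(d)$ independent. All statements are in the limit $n\to\infty$ with $d,\lambda$ fixed. Weak detection: given a single sample from either $\mathrm{WT}(d,\lambda,\mathcal X)$ or $\mathrm{WT}(d)$, each chosen with probability $1/2$, decide which one with success probability at least $\frac12+\varepsilon$ as $n\to\infty$, for some $\varepsilon>0$ not depending on $n$. Weak recovery: given a sample $T$ from $\mathrm{WT}(d,\lambda,\mathcal X)$,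 output a unit vector $\hat x=\hat x(T)$ with $\mathbb E[\langle x,\hat x\rangle^d]\ge\varepsilon$ as $n\to\infty$, for some $\varepsilon>0$ not depending on $n$. These are information-theoretic notions; there is no computational restriction. *)

(* Defs.v *)
From HB Require Import structures.
From mathcomp Require Import all_boot all_order all_algebra perm.
From mathcomp Require Import all_classical all_reals all_analysis measurable_realfun.
Set Implicit Arguments.
Unset Strict Implicit.
Unset Printing Implicit Defensive.
Import Order.TTheory GRing.Theory Num.Theory.
Import numFieldNormedType.Exports.
Local Open Scope classical_set_scope.
Local Open Scope ring_scope.

Section iid_law.
Context d (T : measurableType d) (R : realType).

Definition tuple_cons n (p : T * n.-tuple T) : n.+1.-tuple T :=
  [tuple of p.1 :: p.2].

Lemma measurable_tuple_cons n : measurable_fun setT (@tuple_cons n).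
Proof. exact: measurable_cons. Qed.

HB.instance Definition _ n :=
  isMeasurableFun.Build _ _ _ _ (@tuple_cons n) (@measurable_tuple_cons n).

(* The n-fold product measure P \x ... \x P. *)
Fixpoint iid (P : probability T R) n : probability (n.-tuple T) R :=
  match n with
  | 0 => \d_([tuple] : 0.-tuple T)
  | n'.+1 => distribution (P \x iid P n')%E (@tuple_cons n')
  end.

End iid_law.

Section vectors_and_tensors.
Variable R : realType.

Definition vec n := n.-tuple R.

Definition vdot n (x y : vec n) : R := \sum_(i < n) tnth x i * tnth y i.
Definition vnorm n (x : vec n) : R := Num.sqrt (vdot x x).
Definition mulv n (A : 'M[R]_n) (x : vec n) : vec n :=
  [tuple \sum_(j < n) A i j * tnth x j | i < n].

(* An element of (R^n)^{(x) d} is stored as the tuple of its n ^ d entries, in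
   the order of the enumeration of the multi-indices 'I_d -> 'I_n, so that it
   carries the library's product sigma-algebra. *)
Definition midx d n := {ffun 'I_d -> 'I_n}.
Definition tensor d n := #|{: midx d n}|.-tuple R.

Definition entry d n (T : tensor d n) (i : midx d n) : R :=
  tnth T (enum_rank i).
Definition mktensor d n (F : midx d n -> R) : tensor d n :=
  [tuple F (enum_val k) | k < #|{: midx d n}|].

Lemma entryE d n (F : midx d n -> R) i : entry (mktensor F) i = F i.
Proof. by rewrite /entry tnth_mktuple enum_rankK. Qed.

Definition symmetrize d n (T : tensor d n) : tensor d n :=
  mktensor (fun i => (d`!)%:R^-1 *
                     \sum_(s : 'S_d) entry T [ffun k => i (s k)]).

Definition rank1 d n (x : vec n) : tensor d n :=
  mktensor (fun i => \prod_(k < d) tnth x (i k)).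

Lemma measurable_mktensor d0 (S : measurableType d0) d n
    (F : S -> midx d n -> R) :
  (forall i, measurable_fun setT (F ^~ i)) ->
  measurable_fun setT (fun s => mktensor (F s)).
Proof.
move=> mF; apply/measurable_fun_tnthP => k.
rewrite (_ : _ \o _ = F ^~ (enum_val k)); first exact: mF.
by apply/funext => s /=; rewrite tnth_mktuple.
Qed.

Lemma measurable_entry d n (i : midx d n) :
  measurable_fun setT (fun T : tensor d n => entry T i).
Proof. exact: measurable_tnth. Qed.

Lemma measurable_symmetrize d n : measurable_fun setT (@symmetrize d n).
Proof.
apply: measurable_mktensor => i; apply: measurable_funM => //.
by apply: measurable_sum => s; exact: measurable_entry.
Qed.

HB.instance Definition _ d n := isMeasurableFun.Build _ _ _ _
  (@symmetrize d n) (@measurable_symmetrize d n).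

(* normal_prob lives on measurableTypeR R, whose display differs from that of R
   (the sigma-algebras are the same), hence the transport along the identity.
   Its second argument is the standard deviation, not the variance. *)
Definition idTR : measurableTypeR R -> R := idfun.

HB.instance Definition _ :=
  isMeasurableFun.Build _ _ _ _ idTR (@measurable_id _ _ setT).

Definition gauss (variance : R) : probability R R :=
  distribution (normal_prob 0 (Num.sqrt variance)) idTR.

Definition WT d n : probability (tensor d n) R :=
  distribution (iid (gauss (2 / n%:R)) #|{: midx d n}|) (@symmetrize d n).

Definition prior := forall n, probability (vec n) R.

Definition spiked_sample d n (lambda : R) (p : vec n * tensor d n) :
    tensor d n :=
  mktensor (fun i => lambda * entry (rank1 d p.1) i + entry p.2 i).

Lemma measurable_spiked_sample d n lambda :
  measurable_fun setT (@spiked_sample d n lambda).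
Proof.
apply: measurable_mktensor => i; apply: measurable_funD; last first.
  exact: measurableT_comp (measurable_entry i) measurable_snd.
apply: measurable_funM => //=.
under eq_fun do rewrite entryE.
apply: measurable_prod => k _.
exact: measurableT_comp (measurable_tnth (i k)) measurable_fst.
Qed.

HB.instance Definition _ d n lambda := isMeasurableFun.Build _ _ _ _
  (@spiked_sample d n lambda) (@measurable_spiked_sample d n lambda).

Definition WT_spiked d n (lambda : R) (X : prior) : probability (tensor d n) R :=
  distribution (X n \x WT d n)%E (@spiked_sample d n lambda).

(* Success probability of the test phi, where phi T = true means that T is
   declared to be spiked. *)
Definition test_success d n (lambda : R) (X : prior)
    (phi : tensor d n -> bool) : \bar R :=
  (2^-1%:E * WT_spiked d n lambda X [set T | phi T] +
   2^-1%:E * WT d n [set T | ~~ phi T])%E.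

Definition weak_detection d (lambda : R) (X : prior) : Prop :=
  exists2 eps : R, 0 < eps &
  exists2 phi : forall n, tensor d n -> bool,
    forall n, measurable_fun setT (phi n) &
    \forall n \near \oo,
      ((2^-1 + eps)%:E <= test_success lambda X (phi n))%E.

(* The estimator is only required to be unit-valued for n > 0, since there is
   no unit vector in dimension 0. *)
Definition weak_recovery d (lambda : R) (X : prior) : Prop :=
  exists2 eps : R, 0 < eps &
  exists2 xhat : forall n, tensor d n -> vec n,
    forall n, measurable_fun setT (xhat n) /\
              ((0 < n)%N -> forall T, vnorm (xhat n T) = 1) &
    \forall n \near \oo,
      (eps%:E <= 'E_(X n \x WT d n)[
        fun p => (vdot p.1 (xhat n (spiked_sample lambda p)) ^+ d)%R])%E.

(* The uniform distribution on the unit sphere: the rotation-invariant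
   probability measure carried by it. *)
Definition uniform_sphere n (mu : probability (vec n) R) : Prop :=
  mu [set x | vnorm x = 1] = 1%E /\
  forall A : 'M[R]_n, A *m A^T = 1%:M ->
    forall S : set (vec n), measurable S ->
      pushforward mu (mulv A) S = mu S.

Definition spherical_prior (X : prior) : Prop :=
  forall n, (0 < n)%N -> uniform_sphere (X n).

Definition lambda_sph d : R :=
  sup [set l : R | forall t : R, 0 <= t < 1 ->
         l ^+ 2 / 2 * (t ^+ d / (1 + t ^+ d)) <= - (2^-1 * ln (1 - t ^+ 2))].

End vectors_and_tensors.

(* Main.v *)
(* Truncated second moment method. Since x^(tensor d) is symmetric, a test on
   the symmetrized tensor is a test on the tensor with iid Gaussian entries, and
   the planted law has likelihood ratio E_x exp(n lam/2 <x^d, T> - n lam^2/4).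
   Restrict it to the typical event <x^d, T> <= lam + del. A one-sided Chernoff
   tilt by lam / (1 + rho), with rho = <x, y>^d, bounds the expected product of
   two restricted ratios by exp(n (lam^2/2 + lam del) |rho| / (1 + |rho|)),
   which the hypothesis on lam turns into (1 - <x, y>^2)^(- alpha n / 2) with
   alpha < 1.

   Rotation invariance gives M_(k+1) (n + 2k) = (2k+1) M_k for the even moments
   M_k of <x, y>. Integrating the negative binomial series term by term, the
   resulting sum telescopes, so E (1 - <x, y>^2)^(- beta n / 2) stays bounded
   for beta < 1; the spare factor n |<x, y>|^3 (from d >= 3) makes the second
   moment tend to 1 and the estimator correlation tend to 0. *)
From HB Require Import structures.
From mathcomp Require Import all_boot all_order all_algebra perm.
From mathcomp Require Import all_classical all_reals all_analysis.
From mathcomp Require Import measurable_realfun.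
From mathcomp Require Import ring lra zify.
Require Import Defs.
Set Implicit Arguments.
Unset Strict Implicit.
Unset Printing Implicit Defensive.
Import Order.TTheory GRing.Theory Num.Theory.
Import numFieldNormedType.Exports.
Local Open Scope classical_set_scope.
Local Open Scope ring_scope.

(** * Gaussian shifts *)

(** Truncation is what produces the denominator 1 + t^d: the plain likelihood ratio has second
    moment E exp(n lam^2 rho / 2), which would call for the threshold inequality without it. The
    excess comes from tensors correlated with both spikes beyond lam; cutting them off costs at most
    exp(- n del^2 / 4) of planted mass.

    The overlap law is never given a density. Only its even moments enter, through a power series in
    t^2, so the negative power of 1 - t^2 has an integer exponent m, obtained by rounding.

    A typical overlap has size n^(-1/2), so n |t|^3 is of order n^(-1/2): this is the source of the
    vanishing bounds. The same estimate serves both conclusions. For detection it controls the L^2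
    distance to 1 of the averaged truncated ratio. For recovery it controls the squared norm of an
    unnormalised posterior mean of x^(tensor d), and any estimator enters only as a unit tensor
    paired with that mean. *)

Section gaussian_shift.
Variable R : realType.
Local Notation mu := (@lebesgue_measure R).
Local Open Scope ereal_scope.

(** The abstract Radon-Nikodym derivative agrees almost everywhere with [normal_pdf] because both
    have the same integral over every measurable set. *)
Lemma ge0_integral_normal_prob (m s : R) (f : measurableTypeR R -> \bar R) :
  measurable_fun setT f -> (forall x, 0 <= f x) ->
  \int[normal_prob m s]_x f x = \int[mu]_x (f x * (normal_pdf m s x)%:E).
Proof.
move=> mf f0.
have dom := @normal_prob_dominates R m s.
rewrite -(Radon_Nikodym_SigmaFinite.change_of_variables dom)//.
have irn := Radon_Nikodym_SigmaFinite.f_integrable dom.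
have mrn := measurable_int mu irn.
apply: ae_eq_integral => //.
- exact: emeasurable_funM.
- apply: emeasurable_funM => //; apply/measurable_EFinP.
  exact: measurable_normal_pdf.
- apply: ae_eqe_mul2l => /=.
  apply: integral_ae_eq => //=.
  + by apply/measurable_EFinP; exact: measurable_normal_pdf.
  + by move=> E E01 mE; rewrite -Radon_Nikodym_SigmaFinite.f_integral.
Qed.

Lemma ge0_integral_lebesgue_shift (a : R) (f : measurableTypeR R -> \bar R) :
  measurable_fun setT f -> (forall x, 0 <= f x) ->
  \int[mu]_x f (x + a)%R = \int[mu]_x f x.
Proof.
move=> mf f0.
have ma : measurable_fun (setT : set (measurableTypeR R))
    (fun x : measurableTypeR R => (x + a)%R : measurableTypeR R).
  exact: measurable_funD.
rewrite -[LHS](@ge0_integral_pushforward _ _ _ _ _ _ ma mu setT f)//.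
pose aM := isMeasurableFun.Build _ _ _ _ _ ma.
pose aa : {mfun measurableTypeR R >-> measurableTypeR R} :=
  HB.pack (fun x : R => (x + a)%R) aM.
apply: (@eq_measure_integral _ _ _ _ _ (pushforward mu aa)) => A mA _.
apply/esym; apply: (@lebesgue_measure_unique _ (pushforward mu aa)) => //.
move=> _ [[x y] _ <-] /=.
transitivity (mu [set` `](x - a)%R, (y - a)%R]]).
  by rewrite !lebesgue_measure_itv/= !lte_fin ltrD2r -!EFinB opprB addrA addrNK.
congr (mu _); apply/seteqP.
by split => z /=; rewrite !in_itv/= ltrBlDr lerBrDr.
Qed.

(* The one-dimensional Cameron-Martin formula. *)
Lemma ge0_integral_gauss_shift (v a : R) (f : R -> \bar R) : (0 < v)%R ->
  measurable_fun setT f -> (forall x, 0 <= f x) ->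
  \int[gauss v]_x f (a + x)%R =
  \int[gauss v]_x (f x * (expR (a * x / v - a ^+ 2 / (2 * v)))%:E).
Proof.
move=> v0 mf f0.
have mE : measurable_fun setT (fun x => expR (a * x / v - a ^+ 2 / (2 * v))).
  apply: measurableT_comp => //; apply: measurable_funB => //.
  by apply: measurable_funM => //; exact: measurable_funM.
have mfE : measurable_fun setT
    (fun x : R => f x * (expR (a * x / v - a ^+ 2 / (2 * v)))%:E).
  by apply: emeasurable_funM => //; exact/measurable_EFinP.
have mfa : measurable_fun setT (fun x => f (a + x)%R).
  by apply: (measurableT_comp mf); exact: measurable_funD.
rewrite !ge0_integral_distribution//=; last first.
  by move=> y; rewrite mule_ge0// lee_fin expR_ge0.
rewrite !ge0_integral_normal_prob//=.
(* After x -> x - a the ratio of the two densities is exp((x^2 - (x - a)^2) / (2v)), which expands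
   to the stated exponential. *)
rewrite -[LHS](ge0_integral_lebesgue_shift (- a)%R); last 2 first.
  apply: emeasurable_funM; first exact: mfa.
    by apply/measurable_EFinP; exact: measurable_normal_pdf.
  by move=> x; rewrite mule_ge0// lee_fin normal_pdf_ge0.
  apply: eq_integral => x _; rewrite addrC subrK -muleA; congr (_ * _).
  rewrite -EFinM; congr EFin.
  have s0 : Num.sqrt v != 0%R :> R by rewrite sqrtr_eq0 -ltNge.
  rewrite /normal_pdf (negbTE s0) mulrCA; congr (_ * _)%R.
  rewrite /normal_fun -expRD; congr expR.
  rewrite sqr_sqrtr ?ltW// !subr0 /idTR/=; field.
  by rewrite gt_eqF.
by move=> y; rewrite mule_ge0// lee_fin expR_ge0.
Qed.

End gaussian_shift.

Lemma ge0_integral_iidS d (T : measurableType d) (R : realType)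
    (P : probability T R) n (f : n.+1.-tuple T -> \bar R) :
  measurable_fun setT f -> (forall w, 0 <= f w)%E ->
  (\int[iid P n.+1]_w f w = \int[P]_x \int[iid P n]_w f [tuple of x :: w])%E.
Proof.
move=> mf f0; rewrite ge0_integral_distribution// fubini_tonelli1//=.
exact: (measurableT_comp mf (@measurable_tuple_cons _ _ n)).
Qed.

Section vectors.
Variable R : realType.
Implicit Types (n : nat).

Definition addv n (a w : vec R n) : vec R n :=
  [tuple tnth a i + tnth w i | i < n].

Lemma measurable_addv n (a : vec R n) : measurable_fun setT (addv a).
Proof.
apply/measurable_fun_tnthP => i.
rewrite (_ : _ \o _ = fun w : vec R n => tnth a i + tnth w i).
  by apply: measurable_funD => //; exact: measurable_tnth.
by apply/funext => w /=; rewrite tnth_mktuple.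
Qed.

Lemma measurable_vdot d (T : measurableType d) n (f g : T -> vec R n) :
  measurable_fun setT f -> measurable_fun setT g ->
  measurable_fun setT (fun t => vdot (f t) (g t)).
Proof.
move=> mf mg; apply: measurable_sum => i.
by apply: measurable_funM;
  [exact: measurableT_comp (measurable_tnth i) mf
  |exact: measurableT_comp (measurable_tnth i) mg].
Qed.

Lemma vdotC n (x y : vec R n) : vdot x y = vdot y x.
Proof. by apply: eq_bigr => i _; rewrite mulrC. Qed.

Lemma vdot_cons n (a x : R) (b y : vec R n) :
  vdot ([tuple of a :: b] : vec R n.+1) [tuple of x :: y] = a * x + vdot b y.
Proof.
rewrite /vdot big_ord_recl !tnth0; congr (_ + _).
by apply: eq_bigr => i _; rewrite !tnthS.
Qed.

Lemma addv_cons n (a x : R) (b y : vec R n) :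
  addv ([tuple of a :: b] : vec R n.+1) [tuple of x :: y] =
  [tuple of (a + x) :: addv b y].
Proof.
apply: eq_from_tnth => i; rewrite tnth_mktuple.
by case: (unliftP ord0 i) => [j ->|->]; rewrite ?tnthS ?tnth0 ?tnth_mktuple.
Qed.

(* The Cameron-Martin formula. *)
Lemma ge0_integral_iid_gauss_shift (v : R) n (a : vec R n)
    (f : vec R n -> \bar R) : 0 < v ->
  measurable_fun setT f -> (forall x, 0 <= f x)%E ->
  (\int[iid (gauss v) n]_w f (addv a w) =
   \int[iid (gauss v) n]_w
     (f w * (expR (vdot a w / v - vdot a a / (2 * v)))%:E))%E.
Proof.
move=> v0; elim: n => [|n IH] in a f *.
  move=> _ _; apply: eq_integral => w _.
  rewrite /vdot !big_ord0 !mul0r subr0 expR0 mule1 !tuple0; congr f; exact: esym (tuple0 _).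
case: (tupleP a) => {}a b; rewrite -/(vec R n) in b * => mf f0.
have mE k (c : vec R k) :
    measurable_fun setT (fun w => expR (vdot c w / v - vdot c c / (2 * v))).
  apply: measurableT_comp => //; apply: measurable_funB => //.
  by apply: measurable_funM => //; exact: measurable_vdot.
have mEe k (c : vec R k) :
    measurable_fun setT
      (fun w => (expR (vdot c w / v - vdot c c / (2 * v)))%:E).
  by apply/measurable_EFinP; exact: mE.
set c : vec R n.+1 := [tuple of a :: b].
have mfE : measurable_fun setT (fun w : vec R n.+1 =>
    (f w * (expR (vdot c w / v - vdot c c / (2 * v)))%:E)%E).
  by apply: emeasurable_funM => //; exact: mEe.
rewrite !ge0_integral_iidS//; last 2 first.
- by move=> w; rewrite mule_ge0// lee_fin expR_ge0.
- exact: (measurableT_comp mf (measurable_addv _)).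
have mcons z : measurable_fun setT (fun w : vec R n => [tuple of z :: w]).
  exact: measurable_cons.
(* The inner integral once the induction hypothesis has absorbed the shift of the last n
   coordinates; the one-dimensional formula then acts on the first. *)
pose h x := (\int[iid (gauss v) n]_w
  (f [tuple of x :: w] * (expR (vdot b w / v - vdot b b / (2 * v)))%:E))%E.
transitivity (\int[gauss v]_x h (a + x)%R)%E.
  apply: eq_integral => x _; under eq_integral do rewrite /c addv_cons.
  rewrite (IH b (fun w => f [tuple of (a + x) :: w]))//.
  exact: (measurableT_comp mf (mcons _)).
have h0 x : (0 <= h x)%E.
  by apply: integral_ge0 => w _; rewrite mule_ge0// lee_fin expR_ge0.
rewrite ge0_integral_gauss_shift//; last first.
  apply: (measurable_fun_fubini_tonelli_F (fun p : R * vec R n =>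
    (f (tuple_cons p) * (expR (vdot b p.2 / v - vdot b b / (2 * v)))%:E)%E)).
    apply: emeasurable_funM.
      exact: (measurableT_comp mf (@measurable_tuple_cons _ _ n)).
    exact: (measurableT_comp (mEe _ b) measurable_snd).
  by move=> w; rewrite mule_ge0// lee_fin expR_ge0.
apply: eq_integral => x _; rewrite -ge0_integralZr//.
- apply: eq_integral => w _; rewrite /c !vdot_cons -muleA; congr (_ * _)%E.
  rewrite -EFinM -expRD; congr (expR _)%:E.
  by field; rewrite gt_eqF.
- by apply: emeasurable_funM; [exact: (measurableT_comp mf (mcons _))|exact: mEe].
- by move=> w _; rewrite mule_ge0// lee_fin expR_ge0.
Qed.
End vectors.

(** * Bounded measurable functions *)

Section bounded_measurable.
Context d (T : measurableType d) (R : realType).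
Implicit Types (f g : T -> R) (P : probability T R).

(** A class closed under sums, products and partial integration, and integrable for every
    probability measure, so that linearity and Fubini come without separate integrability arguments.
    Likelihood ratios enter it thanks to truncation. *)
Definition bounded_measurable f :=
  measurable_fun setT f /\ exists C : R, forall x, `|f x| <= C.

Lemma bmeas_cst (r : R) : bounded_measurable (fun=> r).
Proof. by split=> //; exists `|r|. Qed.

Lemma bmeasD f g : bounded_measurable f -> bounded_measurable g ->
  bounded_measurable (fun x => f x + g x).
Proof.
move=> [mf [C fC]] [mg [D gD]]; split; first exact: measurable_funD.
by exists (C + D) => x; rewrite (le_trans (ler_normD _ _))// lerD.
Qed.

Lemma bmeasM f g : bounded_measurable f -> bounded_measurable g ->
  bounded_measurable (fun x => f x * g x).
Proof.
move=> [mf [C fC]] [mg [D gD]]; split; first exact: measurable_funM.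
by exists (C * D) => x; rewrite normrM ler_pM.
Qed.

Lemma bmeasZ (r : R) f : bounded_measurable f ->
  bounded_measurable (fun x => r * f x).
Proof. exact: (bmeasM (bmeas_cst r)). Qed.

Lemma bmeasX f k : bounded_measurable f -> bounded_measurable (fun x => f x ^+ k).
Proof.
move=> bf; elim: k => [|k IH].
  by under eq_fun do rewrite expr0; exact: bmeas_cst.
by under eq_fun do rewrite exprS; exact: bmeasM.
Qed.

Lemma bmeas_sum (I : Type) (r : seq I) (F : I -> T -> R) :
  (forall i, bounded_measurable (F i)) ->
  bounded_measurable (fun x => \sum_(i <- r) F i x).
Proof.
move=> bF; elim: r => [|i r IH].
  by under eq_fun do rewrite big_nil; exact: bmeas_cst.
by under eq_fun do rewrite big_cons; exact: bmeasD.
Qed.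

Lemma bmeas_indic (A : set T) : measurable A ->
  bounded_measurable (\1_A : T -> R).
Proof.
move=> mA; split; first exact: measurable_indic.
by exists 1 => x; rewrite indicE; case: (_ \in _); rewrite ?normr1 ?normr0.
Qed.

Lemma bmeas_integrable P f : bounded_measurable f ->
  P.-integrable setT (EFin \o f).
Proof.
move=> [mf [C fC]]; apply: measurable_bounded_integrable => //.
  exact: le_lt_trans (probability_le1 P measurableT) (ltry 1).
exists C; split; first exact: num_real.
by move=> M CM x _; exact: le_trans (fC x) (ltW CM).
Qed.

Lemma EFin_Rintegral P f : bounded_measurable f ->
  (\int[P]_x f x)%:E = (\int[P]_x (f x)%:E)%E.
Proof.
by move=> bf; rewrite fineK//; exact: integrable_fin_num (bmeas_integrable P bf).
Qed.

Lemma Rintegral_prob_cst P (r : R) : \int[P]_x r = r.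
Proof. by rewrite Rintegral_cst// [X in fine X](@probability_setT _ _ _ P) mulr1. Qed.

Lemma bmeas_RintegralD P f g : bounded_measurable f -> bounded_measurable g ->
  \int[P]_x (f x + g x) = \int[P]_x f x + \int[P]_x g x.
Proof. by move=> bf bg; rewrite RintegralD//; exact: bmeas_integrable. Qed.

Lemma bmeas_RintegralZ P (r : R) f : bounded_measurable f ->
  \int[P]_x (r * f x) = r * \int[P]_x f x.
Proof. by move=> bf; rewrite RintegralZl//; exact: bmeas_integrable. Qed.

Lemma bmeas_Rintegral_sum P (I : Type) (r : seq I) (F : I -> T -> R) :
  (forall i, bounded_measurable (F i)) ->
  \int[P]_x (\sum_(i <- r) F i x) = \sum_(i <- r) \int[P]_x F i x.
Proof.
move=> bF; elim: r => [|i r IH].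
  rewrite big_nil; under eq_Rintegral do rewrite big_nil.
  exact: Rintegral_prob_cst.
rewrite big_cons -IH -bmeas_RintegralD//; last exact: bmeas_sum.
by apply: eq_Rintegral => x _; rewrite big_cons.
Qed.

Lemma bmeas_le_Rintegral P f g : bounded_measurable f -> bounded_measurable g ->
  (forall x, f x <= g x) -> \int[P]_x f x <= \int[P]_x g x.
Proof. by move=> bf bg fg; apply: le_Rintegral => //; exact: bmeas_integrable. Qed.

(** The prior is a measure on all of R^n, where overlaps are unbounded. Multiplying by the indicator
    of a set of full measure, later the sphere, brings such integrands back among the bounded
    ones. *)
Lemma integral_full P f (S : set T) : measurable S -> P S = 1%E ->
  measurable_fun setT f ->
  (\int[P]_x (f x)%:E = \int[P]_x (f x * \1_S x)%:E)%E.
Proof.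
move=> mS PS mf; apply: ae_eq_integral => //.
- exact/measurable_EFinP.
- by apply/measurable_EFinP; apply: measurable_funM => //; exact: measurable_indic.
- exists (~` S); split; first exact: measurableC.
    by have := probability_setC P mS; rewrite PS subee.
  move=> x /=; apply: contra_not => xS _.
  by rewrite indicE mem_set// mulr1.
Qed.

Lemma Rintegral_full P f (S : set T) : measurable S -> P S = 1%E ->
  measurable_fun setT f -> \int[P]_x f x = \int[P]_x (f x * \1_S x).
Proof. by move=> mS PS mf; congr fine; exact: integral_full. Qed.

Lemma le_Rintegral_full P f g (S : set T) : measurable S -> P S = 1%E ->
  bounded_measurable f -> bounded_measurable g ->
  (forall x, S x -> f x <= g x) -> \int[P]_x f x <= \int[P]_x g x.
Proof.
move=> mS PS bf bg fg.
rewrite (Rintegral_full mS PS)//; last by case: bf.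
rewrite [leRHS](Rintegral_full mS PS)//; last by case: bg.
apply: bmeas_le_Rintegral => [||x].
- by apply: bmeasM => //; exact: bmeas_indic.
- by apply: bmeasM => //; exact: bmeas_indic.
- rewrite indicE; case: (boolP (x \in S)) => xS; rewrite ?mulr1 ?mulr0//.
  exact/fg/set_mem.
Qed.

Lemma Rintegral_bound P f C : (forall x, `|f x| <= C) ->
  measurable_fun setT f -> `|\int[P]_x f x| <= C.
Proof.
move=> fC mf; have bf : bounded_measurable f by split=> //; exists C.
rewrite (le_trans (le_normr_Rintegral _ (bmeas_integrable P bf)))//.
rewrite -[leRHS](Rintegral_prob_cst P C); apply: bmeas_le_Rintegral => //.
- by split; [exact: measurableT_comp|exists C => x; rewrite normr_id].
- exact: bmeas_cst.
Qed.

End bounded_measurable.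

Section bounded_fubini.
Context d1 d2 (T1 : measurableType d1) (T2 : measurableType d2) (R : realType).
Variables (P : probability T1 R) (Q : probability T2 R).
Variable f : T1 * T2 -> R.
Hypothesis bf : bounded_measurable f.

Lemma bmeas_pairl x : bounded_measurable (fun y => f (x, y)).
Proof.
by case: bf => mf [C fC]; split; [exact: measurableT_comp|exists C].
Qed.

Lemma bmeas_pairr y : bounded_measurable (fun x => f (x, y)).
Proof.
by case: bf => mf [C fC]; split; [exact: measurableT_comp|exists C].
Qed.

Lemma bmeas_Rintegrall : bounded_measurable (fun x => \int[Q]_y f (x, y)).
Proof.
split.
  apply: measurableT_comp => //.
  apply: (measurable_fubini_F (m1 := P) (f := EFin \o f)).
  exact: (bmeas_integrable (P \x Q)%E).
case: bf => mf [C fC]; exists C => x; apply: Rintegral_bound => //.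
exact: measurableT_comp.
Qed.

Lemma bmeas_Rintegralr : bounded_measurable (fun y => \int[P]_x f (x, y)).
Proof.
split.
  apply: measurableT_comp => //.
  apply: (measurable_fubini_G (m2 := Q) (f := EFin \o f)).
  exact: (bmeas_integrable (P \x Q)%E).
case: bf => mf [C fC]; exists C => x; apply: Rintegral_bound => //.
exact: measurableT_comp.
Qed.

Lemma Rintegral_prod : \int[(P \x Q)%E]_z f z = \int[P]_x \int[Q]_y f (x, y).
Proof.
congr fine; rewrite -integral12_prod_meas1; last exact: (bmeas_integrable (P \x Q)%E).
by apply: eq_integral => x _; rewrite EFin_Rintegral//; exact: bmeas_pairl.
Qed.

Lemma Rintegral_swap :
  \int[P]_x \int[Q]_y f (x, y) = \int[Q]_y \int[P]_x f (x, y).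
Proof.
rewrite -Rintegral_prod.
congr fine; rewrite -integral21_prod_meas1; last exact: (bmeas_integrable (P \x Q)%E).
by apply: eq_integral => x _; rewrite EFin_Rintegral//; exact: bmeas_pairr.
Qed.

End bounded_fubini.

(** * Gaussian vectors: signed integrands and exponential moments *)

Section gaussian_vectors.
Variable R : realType.
Implicit Types (n : nat) (v : R).

Definition scalev n (k : R) (a : vec R n) : vec R n :=
  [tuple k * tnth a i | i < n].

Lemma vdotZl n k (a b : vec R n) : vdot (scalev k a) b = k * vdot a b.
Proof.
by rewrite /vdot mulr_sumr; apply: eq_bigr => i _; rewrite tnth_mktuple mulrA.
Qed.

Lemma vdotZr n k (a b : vec R n) : vdot a (scalev k b) = k * vdot a b.
Proof. by rewrite vdotC vdotZl vdotC. Qed.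

Lemma vdotDl n (a b c : vec R n) : vdot (addv a b) c = vdot a c + vdot b c.
Proof.
rewrite /vdot -big_split/=; apply: eq_bigr => i _.
by rewrite tnth_mktuple mulrDl.
Qed.

Lemma vdotDr n (a b c : vec R n) : vdot a (addv b c) = vdot a b + vdot a c.
Proof. by rewrite vdotC vdotDl !(vdotC _ a). Qed.

Lemma Rintegral_iid_gauss_shift v n (a : vec R n) (f : vec R n -> R) : 0 < v ->
  measurable_fun setT f ->
  \int[iid (gauss v) n]_w f (addv a w) =
  \int[iid (gauss v) n]_w (f w * expR (vdot a w / v - vdot a a / (2 * v))).
Proof.
move=> v0 mf; congr fine; rewrite [LHS]integralE [RHS]integralE.
congr (_ - _)%E.
- rewrite -[LHS]/(\int[iid (gauss v) n]_w ((EFin \o f) \o addv a)^\+ w)%E.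
  rewrite funepos_comp (ge0_integral_iid_gauss_shift a v0)//.
  + apply: eq_integral => w _; rewrite !funeposE/= [LHS]muleC.
    by rewrite maxe_pMr ?lee_fin ?expR_ge0// mule0 -EFinM mulrC.
  + by apply: measurable_funepos; exact/measurable_EFinP.
- rewrite -[LHS]/(\int[iid (gauss v) n]_w ((EFin \o f) \o addv a)^\- w)%E.
  rewrite funeneg_comp (ge0_integral_iid_gauss_shift a v0)//.
  + apply: eq_integral => w _; rewrite !funenegE/= [LHS]muleC.
    by rewrite maxe_pMr ?lee_fin ?expR_ge0// mule0 -EFinM mulrN mulrC.
  + by apply: measurable_funeneg; exact/measurable_EFinP.
Qed.

(** Cameron-Martin with shift v b applied to the constant exp(v |b|^2 / 2): the exponential factor
    exp(<b, w> - v |b|^2 / 2) cancels that constant. *)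
Lemma integral_iid_gauss_expR v n (b : vec R n) : 0 < v ->
  (\int[iid (gauss v) n]_w (expR (vdot b w))%:E =
   (expR (v / 2 * vdot b b))%:E)%E.
Proof.
move=> v0.
have v1 : v != 0 by rewrite gt_eqF.
have := @ge0_integral_iid_gauss_shift _ v n (scalev v b)
  (fun=> (expR (v / 2 * vdot b b))%:E) v0.
rewrite integral_cst//= [X in (_ * X)%E](@probability_setT _ _ _ (iid (gauss v) n)).
rewrite mule1 => H; rewrite [RHS]H//.
apply: eq_integral => w _; rewrite -EFinM -expRD; congr (expR _)%:E.
by rewrite !vdotZl !vdotZr; field.
Qed.

End gaussian_vectors.

(** * Rank-one tensors and symmetrization *)

Section rank_one_tensors.
Variable R : realType.

Lemma vdot_rank1 d n (x y : vec R n) : vdot (rank1 d x) (rank1 d y) = vdot x y ^+ d.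
Proof.
(* Reading the power as a product over ['I_d] lets it distribute into a sum over multi-indices. *)
rewrite -[X in _ ^+ X](card_ord d) -prodr_const /vdot.
rewrite bigA_distr_bigA /=.
rewrite (reindex (@enum_val (midx d n) predT))/=.
  apply: eq_bigr => k _; rewrite !tnth_mktuple -big_split/=.
  by apply: eq_bigr.
by exists enum_rank => i _; [exact: enum_valK|exact: enum_rankK].
Qed.

Lemma measurable_rank1 d n : measurable_fun setT (@rank1 R d n).
Proof.
apply: measurable_mktensor => i; apply: measurable_prod => k _.
exact: measurable_tnth.
Qed.

Lemma spiked_sample_symmetrize d n lambda (x : vec R n) (W : tensor R d n) :
  spiked_sample lambda (x, symmetrize W) =
  symmetrize (addv (scalev lambda (rank1 d x)) W).
Proof.
congr mktensor; apply/funext => i; rewrite !entryE/=.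
under [in RHS]eq_bigr do rewrite /entry !tnth_mktuple.
rewrite big_split/= mulrDr; congr (_ + _).
rewrite -mulr_sumr mulrCA; congr (_ * _).
rewrite [X in _ = _ * X](eq_bigr (fun=> \prod_(k < d) tnth x (i k))); last first.
  move=> s _; rewrite enum_rankK [RHS](reindex_inj (@perm_inj _ s))/=.
  by apply: eq_bigr => k _; rewrite ffunE.
rewrite sumr_const card_Sn -[X in _ * X]mulr_natl mulrA mulVf ?mul1r//.
Qed.

End rank_one_tensors.

(** * The truncated likelihood ratio *)

Section truncated_likelihood.
Variables (R : realType) (d n : nat) (lam del : R).
Hypotheses (n0 : (0 < n)%N) (lam0 : 0 <= lam) (del0 : 0 <= del).
Local Notation N := (n%:R : R).
Local Notation T := (tensor R d n).

Definition noise : probability T R :=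
  iid (gauss (2 / n%:R)) #|{: midx d n}|.

(** The condition bears on the observed tensor. At lam x^(tensor d) + W with x a unit vector it says
    <x^(tensor d), W> <= del, where the left side is a centred Gaussian of variance 2 / n. *)
Definition typical : set (vec R n * T) :=
  [set p | vdot (rank1 d p.1) p.2 <= lam + del].

(* The likelihood ratio of the planted tensor, restricted to the event that
   the noise is not positively correlated with the spike. *)
Definition trunc_lik (p : vec R n * T) : R :=
  expR (n%:R * lam / 2 * vdot (rank1 d p.1) p.2 - n%:R * lam ^+ 2 / 4) *
  \1_typical p.

Let N0 : 0 < N. Proof. by rewrite ltr0n. Qed.
Let Nneq0 : N != 0. Proof. by rewrite gt_eqF. Qed.
Let v0 : 0 < 2 / N. Proof. by rewrite divr_gt0. Qed.

Lemma measurable_correlation :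
  measurable_fun setT (fun p : vec R n * T => vdot (rank1 d p.1) p.2).
Proof.
apply: measurable_vdot; last exact: measurable_snd.
exact: measurableT_comp (@measurable_rank1 R d n) measurable_fst.
Qed.

Lemma measurable_typical : measurable typical.
Proof.
rewrite (_ : typical =
  (fun p => vdot (rank1 d p.1) p.2) @^-1` [set` `]-oo, lam + del]]); last first.
  by apply/seteqP; split => p /=; rewrite in_itv.
by rewrite -[X in measurable X]setTI; exact: measurable_correlation.
Qed.

Lemma trunc_lik_ge0 p : 0 <= trunc_lik p.
Proof. by rewrite mulr_ge0 ?expR_ge0// indicE ler0n. Qed.

Lemma bmeas_trunc_lik : bounded_measurable trunc_lik.
Proof.
split.
  apply: measurable_funM; last exact: measurable_indic measurable_typical.
  apply: measurableT_comp => //; apply: measurable_funB => //.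
  by apply: measurable_funM => //; exact: measurable_correlation.
exists (expR (N * lam / 2 * (lam + del))) => p.
rewrite ger0_norm ?trunc_lik_ge0// /trunc_lik indicE.
case: (boolP (p \in typical)) => [/set_mem/= pt|]; last first.
  by rewrite mulr0 expR_ge0.
rewrite mulr1 ler_expR (@le_trans _ _ (N * lam / 2 * vdot (rank1 d p.1) p.2))//.
  by rewrite gerBl// divr_ge0// mulr_ge0// ?sqr_ge0// ltW.
by rewrite ler_wpM2l// divr_ge0// mulr_ge0// ltW.
Qed.

Lemma vdot_rank1_unit (x : vec R n) : vdot x x = 1 ->
  vdot (rank1 d x) (rank1 d x) = 1.
Proof. by move=> x1; rewrite vdot_rank1 x1 expr1n. Qed.

(** Cameron-Martin with variance 2 / n and shift lam x^(tensor d), a tensor of norm lam; this is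
    where the coefficients n lam / 2 and n lam^2 / 4 of [trunc_lik] come from. *)
Lemma Rintegral_planted (x : vec R n) (f : T -> R) : vdot x x = 1 ->
  measurable_fun setT f ->
  \int[noise]_W (f (addv (scalev lam (rank1 d x)) W) *
    \1_typical (x, addv (scalev lam (rank1 d x)) W)) =
  \int[noise]_W (f W * trunc_lik (x, W)).
Proof.
move=> x1 mf.
have mft : measurable_fun setT (fun W => f W * \1_typical (x, W)).
  apply: measurable_funM => //.
  have mi : measurable_fun setT (\1_typical : _ -> R).
    exact: measurable_indic measurable_typical.
  exact: (measurableT_comp mi (measurable_pair1 x)).
rewrite /noise.
rewrite (@Rintegral_iid_gauss_shift R _ _ (scalev lam (rank1 d x)) (fun W => f W * \1_typical (x, W)) v0 mft).
apply: eq_Rintegral => W _; rewrite /trunc_lik -mulrA; congr (_ * _).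
rewrite mulrC; congr (expR _ * _).
by rewrite /= !vdotZl vdotZr vdot_rank1_unit//; field.
Qed.

Lemma Rintegral_trunc_lik_ge (x : vec R n) : vdot x x = 1 ->
  1 - expR (- (N * del ^+ 2 / 4)) <= \int[noise]_W trunc_lik (x, W).
Proof.
move=> x1.
under eq_Rintegral do rewrite -[trunc_lik _]mul1r.
rewrite -(Rintegral_planted x1 (@measurable_cst _ _ _ _ setT (1 : R))).
under eq_Rintegral do rewrite mul1r.
have bt : bounded_measurable
    (fun W => \1_typical (x, addv (scalev lam (rank1 d x)) W) : R).
  split; last by exists 1 => W; rewrite indicE; case: (_ \in _); rewrite ?normr1 ?normr0.
  have mi : measurable_fun setT (\1_typical : _ -> R).
    exact: measurable_indic measurable_typical.
  exact: (measurableT_comp mi (measurableT_comp (measurable_pair1 x) (measurable_addv _))).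
rewrite lerBlDl -lerBlDr -[X in X - _](Rintegral_prob_cst noise 1) -mulN1r.
rewrite -bmeas_RintegralZ// -bmeas_RintegralD//; last 2 first.
- exact: bmeas_cst.
- exact: bmeasZ.
rewrite -lee_fin EFin_Rintegral; last first.
  by apply: bmeasD; [exact: bmeas_cst|exact: bmeasZ].
(* Chernoff bound for <x^(tensor d), W> > del: the factor s = N del / 2 minimizes s^2 / N - s del,
   with minimum - N del^2 / 4. *)
pose b : T := scalev (N * del / 2) (rank1 d x).
have mb : measurable_fun setT (fun W : T => (expR (vdot b W))%:E).
  apply/measurable_EFinP; apply: measurableT_comp => //.
  exact: measurable_vdot.
rewrite (@le_trans _ _ (\int[noise]_W ((expR (- (N * del ^+ 2 / 2)))%:E *
    (expR (vdot b W))%:E)))%E//.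
  apply: ge0_le_integral => //.
  - apply/measurable_EFinP.
    by case: (bmeasD (bmeas_cst T (1 : R)) (bmeasZ (-1) bt)).
  - exact: emeasurable_funM.
  - move=> W _; rewrite -EFinM lee_fin -expRD vdotZl mulN1r indicE.
    case: (boolP ((_, _) \in typical)) => [_|]; first by rewrite subrr expR_ge0.
    rewrite notin_setE/= => /negP; rewrite -ltNge vdotDr vdotZr vdot_rank1_unit//.
    rewrite mulr1 ltrD2l subr0 => h; rewrite -expR0 ler_expR.
    rewrite (_ : _ + _ = N * del / 2 * (vdot (rank1 d x) W - del)); last by field.
    by rewrite mulr_ge0 ?divr_ge0 ?mulr_ge0 ?subr_ge0// ltW.
rewrite ge0_integralZl//.
rewrite integral_iid_gauss_expR// -EFinM lee_fin -expRD ler_expR.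
rewrite vdotZl vdotZr vdot_rank1_unit//.
by rewrite le_eqVlt; apply/orP; left; apply/eqP; field.
Qed.

(** On both events the correlations p and q are at most lam + del, so lowering their coefficient
    from N lam / 2 to N th / 2 costs at most the constant N (lam - th) (lam + del) in the exponent.
    The truncation is then dropped and a Gaussian exponential moment remains. *)
Lemma Rintegral_trunc_lik2_tilt (x y : vec R n) (th : R) :
  vdot x x = 1 -> vdot y y = 1 -> 0 <= th <= lam ->
  \int[noise]_W (trunc_lik (x, W) * trunc_lik (y, W)) <=
  expR (N * (th ^+ 2 * (1 + vdot x y ^+ d) / 2 + (lam - th) * (lam + del) -
    lam ^+ 2 / 2)).
Proof.
move=> x1 y1 /andP[th0 thl].
have bl z : bounded_measurable (fun W => trunc_lik (z, W)).
  exact: bmeas_pairl bmeas_trunc_lik z.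
rewrite -lee_fin EFin_Rintegral; last exact: bmeasM.
pose b : T := scalev (N * th / 2) (addv (rank1 d x) (rank1 d y)).
pose k := N * (lam - th) * (lam + del) - N * lam ^+ 2 / 2.
have mb : measurable_fun setT (fun W : T => (expR (vdot b W))%:E).
  apply/measurable_EFinP; apply: measurableT_comp => //.
  exact: measurable_vdot.
rewrite (@le_trans _ _ (\int[noise]_W ((expR k)%:E * (expR (vdot b W))%:E)))%E//.
  apply: ge0_le_integral => //.
  - by move=> W _; rewrite lee_fin mulr_ge0// trunc_lik_ge0.
  - by apply/measurable_EFinP; case: (bmeasM (bl x) (bl y)).
  - by apply: emeasurable_funM.
  - move=> W _; rewrite -EFinM lee_fin -expRD /trunc_lik !indicE.
    case: (boolP (_ \in _)) => [/set_mem/= hx|]; last first.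
      by rewrite mulr0 mul0r expR_ge0.
    case: (boolP (_ \in _)) => [/set_mem/= hy|]; last first.
      by rewrite !mulr0 expR_ge0.
    rewrite !mulr1 -expRD ler_expR vdotZl vdotDl -subr_ge0 /k.
    set p := vdot _ _ in hx *; set q := vdot _ _ in hy *.
    rewrite (_ : _ - _ = N / 2 * ((lam - th) * ((lam + del - p) + (lam + del - q)))).
      apply: mulr_ge0; first by rewrite divr_ge0// ltW.
      by apply: mulr_ge0; [|apply: addr_ge0]; rewrite subr_ge0.
    by field.
rewrite ge0_integralZl//.
rewrite integral_iid_gauss_expR// -EFinM lee_fin -expRD ler_expR.
rewrite vdotZl vdotZr vdotDl !vdotDr !vdot_rank1_unit// (vdotC (rank1 d y)).
rewrite vdot_rank1 /k.
by rewrite le_eqVlt; apply/orP; left; apply/eqP; field.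
Qed.

Lemma Rintegral_trunc_lik2_le (x y : vec R n) :
  vdot x x = 1 -> vdot y y = 1 ->
  \int[noise]_W (trunc_lik (x, W) * trunc_lik (y, W)) <=
  expR (N * (lam ^+ 2 / 2 + lam * del) *
    (`|vdot x y| ^+ d / (1 + `|vdot x y| ^+ d))).
Proof.
move=> x1 y1; rewrite -normrX; set r := vdot x y ^+ d.
have c0 : 0 <= N * (lam ^+ 2 / 2 + lam * del).
  by rewrite mulr_ge0 ?addr_ge0 ?divr_ge0 ?sqr_ge0 ?mulr_ge0// ltW.
have [r0|r0] := leP 0 r.
  have r1 : 0 < 1 + r by rewrite ltr_wpDr.
  (* This value minimizes the exponent in th when del = 0; the slack then only adds lam del r / (1 +
     r). *)
  have := @Rintegral_trunc_lik2_tilt x y (lam / (1 + r)) x1 y1.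
  rewrite divr_ge0 ?(ltW r1)//= ler_pdivrMr// ler_peMr ?lerDl//.
  move=> /(_ isT)/le_trans; apply.
  rewrite ger0_norm// ler_expR le_eqVlt; apply/orP; left; apply/eqP.
  by rewrite -/r; field; rewrite gt_eqF.
(* For r < 0 the previous tilt would exceed lam. Without tilting the exponent is N lam^2 r / 2 <= 0,
   which is enough. *)
have := @Rintegral_trunc_lik2_tilt x y lam x1 y1.
rewrite lam0 lexx => /(_ isT)/le_trans; apply.
rewrite ler_expR (@le_trans _ _ 0)//; last first.
  by rewrite mulr_ge0// divr_ge0// addr_ge0.
rewrite pmulr_rle0// -/r (_ : _ - _ = lam ^+ 2 / 2 * r); last by field.
by rewrite mulr_ge0_le0 ?divr_ge0 ?sqr_ge0// ltW.
Qed.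

End truncated_likelihood.

(** * Moments of the overlap on the sphere *)

Section dot_product.
Variables (R : realType) (n : nat).
Implicit Types x y u v w : vec R n.

Lemma vdot_ge0 x : 0 <= vdot x x.
Proof. by apply: sumr_ge0 => i _; rewrite -expr2 sqr_ge0. Qed.

Lemma vdot_eq0 x : vdot x x = 0 -> forall i, tnth x i = 0.
Proof.
move/eqP; rewrite psumr_eq0 => [|i _]; last by rewrite -expr2 sqr_ge0.
by move=> /allP h i; apply/eqP; have := h i (mem_index_enum _); rewrite mulf_eq0 orbb.
Qed.

Lemma vnorm1E x : (vnorm x = 1) <-> (vdot x x = 1).
Proof.
rewrite /vnorm; split=> [h|->]; last by rewrite sqrtr1.
by rewrite -[LHS]sqr_sqrtr ?vdot_ge0// h expr1n.
Qed.

Lemma normr_vdot_le x y : `|vdot x y| <= (vdot x x + vdot y y) / 2.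
Proof.
have h (c : R) : c ^+ 2 = 1 -> 0 <= vdot x x + vdot y y + 2 * c * vdot x y.
  move=> c1; have := vdot_ge0 (addv x (scalev c y)).
  rewrite vdotDl !vdotDr !vdotZl !vdotZr (vdotC y x) [c * (c * _)]mulrA -expr2 c1.
  by congr (0 <= _); ring.
have := h 1 (expr1n _ 2); have := h (-1) (etrans (sqrrN 1) (expr1n _ 2)).
by rewrite ler_norml => h1 h2; apply/andP; split; lra.
Qed.

(** The reflection along u when c = 2 / <u, u>. Leaving c free lets c = 0 give the identity, which
    covers u = 0. *)
Definition householder u (c : R) : 'M[R]_n :=
  \matrix_(i, j) ((i == j)%:R - c * tnth u i * tnth u j).

Lemma mulv_householder u c x :
  mulv (householder u c) x = addv x (scalev (- c * vdot u x) u).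
Proof.
apply: eq_from_tnth => i; rewrite !tnth_mktuple.
under eq_bigr do rewrite mxE mulrBl.
rewrite sumrB (bigD1 i)//= eqxx mul1r big1 ?addr0; last first.
  by move=> j /negPf; rewrite eq_sym => ->; rewrite mul0r.
congr (_ + _); rewrite !mulNr; congr (- _).
by rewrite /vdot mulr_sumr mulr_suml; apply: eq_bigr => j _; ring.
Qed.

Lemma householder_orthogonal u c : c * vdot u u = 2 ->
  householder u c *m (householder u c)^T = 1%:M.
Proof.
move=> cu; apply/matrixP => i j; rewrite !mxE.
under eq_bigr do rewrite !mxE mulrBl.
rewrite sumrB (bigD1 i)//= eqxx mul1r big1 ?addr0; last first.
  by move=> k /negPf; rewrite eq_sym => ->; rewrite mul0r.
rewrite [X in _ - X](eq_bigr (fun k => c * tnth u i * (tnth u k * (k == j)%:R) -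
   c * c * tnth u i * tnth u j * (tnth u k * tnth u k))); last first.
  by move=> k _; rewrite (eq_sym j k); ring.
rewrite sumrB -!mulr_sumr -/(vdot u u) (bigD1 j)//= eqxx mulr1 big1 ?addr0; last first.
  by move=> k /negPf ->; rewrite mulr0.
rewrite (eq_sym j i).
transitivity ((i == j)%:R - c * tnth u i * tnth u j * (2 - c * vdot u u)); first by ring.
by rewrite cu subrr mulr0 subr0.
Qed.

(** The reflection along v - w exchanges two vectors of equal norm. It is stated in dual form
    because invariance of the measure is applied to x -> <x, w>. *)
Lemma reflection_exists v w : vdot v v = vdot w w ->
  exists A : 'M[R]_n, [/\ A *m A^T = 1%:M,
    forall x, vdot (mulv A x) w = vdot x v &
    forall x, vdot (mulv A x) (mulv A x) = vdot x x].
Proof.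
move=> vw; pose u := addv v (scalev (-1) w).
have uE x : vdot u x = vdot v x - vdot w x by rewrite vdotDl vdotZl mulN1r.
have uuE : vdot u u = 2 * (vdot w w - vdot v w).
  by rewrite uE !(vdotC _ u) !uE (vdotC w v) vw; ring.
have [u0|u0] := eqVneq (vdot u u) 0.
  exists (householder u 0).
  have AE x : mulv (householder u 0) x = x.
    rewrite mulv_householder; apply: eq_from_tnth => i.
    by rewrite tnth_mktuple [X in _ + X]tnth_mktuple (vdot_eq0 u0) mulr0 addr0.
  split=> [|x|x]; rewrite ?AE//.
    apply/matrixP => i j; rewrite !mxE.
    under eq_bigr do rewrite !mxE !mul0r !subr0.
    rewrite (bigD1 i)//= eqxx mul1r big1 ?addr0 1?eq_sym// => k /negPf.
    by rewrite eq_sym => ->; rewrite mul0r.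
  apply/eqP; rewrite -subr_eq0 !(vdotC x) -opprB -uE oppr_eq0.
  by rewrite /vdot big1// => i _; rewrite (vdot_eq0 u0) mul0r.
pose c := 2 / vdot u u.
have cu : c * vdot u u = 2 by rewrite divfK.
exists (householder u c); split=> [|x|x]; first exact: householder_orthogonal.
  rewrite mulv_householder vdotDl vdotZl [vdot u w]uE.
  have -> : vdot v w - vdot w w = - (vdot u u / 2) by rewrite uuE; field.
  rewrite (_ : _ * - _ = vdot u x * (c * vdot u u) / 2); last by field.
  by rewrite cu mulfK// uE !(vdotC x); ring.
rewrite mulv_householder vdotDl !vdotDr !vdotZl !vdotZr (vdotC x u).
transitivity (vdot x x - c * vdot u x ^+ 2 * (2 - c * vdot u u)); first by ring.
by rewrite cu subrr mulr0 subr0.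
Qed.

End dot_product.

Lemma poly_fun_inj (R : realFieldType) (p q : {poly R}) :
  (forall b, p.[b] = q.[b]) -> p = q.
Proof.
move=> pq; apply/eqP; rewrite -subr_eq0; apply/eqP.
apply: (@roots_geq_poly_eq0 _ _ [seq i%:R | i <- iota 0 (size (p - q))]).
- by apply/allP => b _; rewrite rootE hornerD hornerN pq subrr.
- by rewrite map_inj_uniq ?iota_uniq// => i j /eqP; rewrite eqr_nat => /eqP.
- by rewrite size_map size_iota.
Qed.

Lemma coef2_pow_1X2 (R : comNzRingType) k : ((1 + 'X^2 : {poly R}) ^+ k)`_2 = k%:R.
Proof.
have c0 m : ((1 + 'X^2 : {poly R}) ^+ m)`_0 = 1.
  by rewrite -horner_coef0 horner_exp !hornerE expr0n/= addr0 expr1n.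
elim: k => [|k IH]; first by rewrite expr0 coef1.
by rewrite exprS mulrDl mul1r coefD IH coefXnM/= c0 -natr1.
Qed.

Section spherical_moments.
Variables (R : realType) (n : nat) (P : probability (vec R n) R).
Hypothesis n0 : (0 < n)%N.
Hypothesis Pu : uniform_sphere P.

Definition sphere : set (vec R n) := [set x | vdot x x = 1].

Lemma measurable_sphere : measurable sphere.
Proof.
rewrite (_ : sphere = (fun x => vdot x x) @^-1` [set 1])//.
rewrite -[X in measurable X]setTI.
by apply: (measurable_vdot (@measurable_id _ _ setT) (@measurable_id _ _ setT)).
Qed.

Lemma sphere_full : P sphere = 1%E.
Proof.
case: Pu => <- _; congr (P _).
by apply/seteqP; split => x; rewrite /sphere/= vnorm1E.
Qed.

Lemma measurable_mulv (A : 'M[R]_n) : measurable_fun setT (mulv A).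
Proof.
apply/measurable_fun_tnthP => i.
rewrite (_ : _ \o _ = fun x : vec R n => \sum_j A i j * tnth x j).
  by apply: measurable_sum => j; apply: measurable_funM => //; exact: measurable_tnth.
by apply/funext => x /=; rewrite tnth_mktuple.
Qed.

Lemma Rintegral_mulv (A : 'M[R]_n) (f : vec R n -> R) :
  A *m A^T = 1%:M -> bounded_measurable f ->
  \int[P]_x f (mulv A x) = \int[P]_x f x.
Proof.
move=> AA bf; congr fine.
have mf : measurable_fun setT (EFin \o f) by apply/measurable_EFinP; case: bf.
transitivity (\int[pushforward P (mulv A)]_x (EFin \o f) x)%E; last first.
  apply: eq_measure_integral => [|mA S mS _]; first exact: measurable_mulv.
  by case: Pu => _ inv; exact: inv.
rewrite (integral_pushforward (measurable_mulv A))//.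
apply: (bmeas_integrable P (f := f \o mulv A)); case: bf => mf' [C fC]; split.
  exact: measurableT_comp mf' (measurable_mulv A).
by exists C => x; exact: fC.
Qed.

Lemma normr_tnth_le1 x i : sphere x -> `|tnth x i| <= 1.
Proof.
rewrite /sphere/= => x1; rewrite -(expr_le1 (n := 2))// -normrX ger0_norm ?sqr_ge0//.
rewrite -x1 /vdot (bigD1 i)//= -expr2 lerDl.
by apply: sumr_ge0 => j _; rewrite -expr2 sqr_ge0.
Qed.

Lemma bmeas_sphere_coord i :
  bounded_measurable (fun x : vec R n => tnth x i * \1_sphere x : R).
Proof.
split.
  apply: measurable_funM; first exact: measurable_tnth.
  exact: measurable_indic measurable_sphere.
exists 1 => x; rewrite indicE; case: (boolP (_ \in _)) => [/set_mem xs|_].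
  by rewrite mulr1 normr_tnth_le1.
by rewrite mulr0 normr0.
Qed.

Lemma indicX (T : Type) (S : set T) (x : T) k : \1_S x ^+ k.+1 = \1_S x :> R.
Proof. by rewrite indicE; case: (_ \in _); rewrite ?expr1n ?expr0n. Qed.

Lemma bmeas_sphere_monomial k l i j :
  bounded_measurable (fun x : vec R n => tnth x i ^+ k * tnth x j ^+ l * \1_sphere x : R).
Proof.
have bi : bounded_measurable (\1_sphere : vec R n -> R).
  exact: bmeas_indic measurable_sphere.
rewrite (_ : (fun x => _) = fun x => \1_sphere x *
  ((tnth x i * \1_sphere x) ^+ k * (tnth x j * \1_sphere x) ^+ l)).
  apply: bmeasM => //; apply: bmeasM; apply: bmeasX; exact: bmeas_sphere_coord.
apply/funext => x; rewrite indicE.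
by case: (_ \in _); rewrite ?mulr1 ?mul1r ?mulr0 ?mul0r.
Qed.

Lemma bmeas_sphere_vdot v k :
  bounded_measurable (fun x => vdot x v ^+ k * \1_sphere x : R).
Proof.
have bi : bounded_measurable (\1_sphere : vec R n -> R).
  exact: bmeas_indic measurable_sphere.
rewrite (_ : (fun x => _) = fun x => \1_sphere x *
    (\sum_i (tnth v i * (tnth x i * \1_sphere x))) ^+ k).
  apply: bmeasM => //; apply: bmeasX; apply: bmeas_sum => i.
  by apply: bmeasZ; exact: bmeas_sphere_coord.
apply/funext => x; rewrite indicE; case: (_ \in _); rewrite ?mulr0 ?mul0r//.
rewrite mulr1 mul1r; congr (_ ^+ k).
by apply: eq_bigr => i _; rewrite mulr1 mulrC.
Qed.

Definition moment k (v : vec R n) : R := \int[P]_x (vdot x v ^+ k * \1_sphere x).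

Lemma moment_rotate k v w : vdot v v = vdot w w -> moment k v = moment k w.
Proof.
move=> /reflection_exists[A [AA Aw As]]; rewrite /moment.
rewrite -[RHS](Rintegral_mulv AA)//; last exact: bmeas_sphere_vdot.
apply: eq_Rintegral => x _; rewrite Aw; congr (_ * _).
rewrite !indicE; congr (_%:R); congr nat_of_bool.
by apply/idP/idP => /set_mem h; apply/mem_set; move: h; rewrite /sphere/= As.
Qed.

Definition basisv (i : 'I_n) : vec R n := [tuple (j == i)%:R | j < n].

Lemma vdot_basisv x i : vdot x (basisv i) = tnth x i.
Proof.
rewrite /vdot (bigD1 i)//= tnth_mktuple eqxx mulr1 big1 ?addr0// => j /negPf ji.
by rewrite tnth_mktuple ji mulr0.
Qed.

Definition mom2 k := moment (2 * k) (basisv (Ordinal n0)).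

Lemma moment_unit k v : vdot v v = 1 -> moment (2 * k) v = mom2 k.
Proof.
by move=> v1; apply: moment_rotate; rewrite v1 vdot_basisv tnth_mktuple eqxx.
Qed.

Lemma mom2_0 : mom2 0 = 1.
Proof.
rewrite /mom2 /moment muln0.
under eq_Rintegral do rewrite expr0.
rewrite -(Rintegral_full measurable_sphere sphere_full)//.
exact: Rintegral_prob_cst.
Qed.

Lemma mom2_ge0 k : 0 <= mom2 k.
Proof.
apply: Rintegral_ge0 => x _.
by rewrite mulr_ge0 ?indicE ?ler0n// exprM exprn_ge0// sqr_ge0.
Qed.

(* Comparing coefficients of b^2 in E<x, e_0 + b e_j>^(2k) = (1 + b^2)^k E<x, e_0>^(2k). *)
Lemma mixed_moment k j : j != Ordinal n0 ->
  (2 * k).+1%:R * \int[P]_x (tnth x (Ordinal n0) ^+ (2 * k) * tnth x j ^+ 2 *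
     \1_sphere x) = mom2 k.+1.
Proof.
set i0 := Ordinal n0 => ji.
pose mm l := \int[P]_x (tnth x i0 ^+ (2 * k.+1 - l) * tnth x j ^+ l * \1_sphere x).
pose p : {poly R} := \poly_(l < (2 * k.+1).+1) ('C(2 * k.+1, l)%:R * mm l).
have pE : p = mom2 k.+1 *: (1 + 'X^2) ^+ k.+1.
  apply: poly_fun_inj => b; rewrite hornerZ horner_exp !hornerE.
  (* Its 2(k+1)-th moment is computed twice: by the binomial formula, and by rotating it to sqrt(1 +
     b^2) e_0. Agreement for all b gives an identity of polynomials in b. *)
  pose v := addv (basisv i0) (scalev b (basisv j)).
  have vv : vdot v v = 1 + b ^+ 2.
    rewrite vdotDl !vdotDr !vdotZl !vdotZr !vdot_basisv !tnth_mktuple !eqxx.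
    rewrite (negPf ji) eq_sym (negPf ji) /=; ring.
  transitivity (moment (2 * k.+1) v).
    rewrite horner_poly.
    transitivity (\int[P]_x \sum_(l < (2 * k.+1).+1) (('C(2 * k.+1, l)%:R * b ^+ l) *
      (tnth x i0 ^+ (2 * k.+1 - l) * tnth x j ^+ l * \1_sphere x))).
      rewrite bmeas_Rintegral_sum; last first.
        by move=> l; apply: bmeasZ; exact: bmeas_sphere_monomial.
      apply: eq_bigr => l _; rewrite bmeas_RintegralZ; last exact: bmeas_sphere_monomial.
      by rewrite -/(mm l); ring.
    apply: eq_Rintegral => x _.
    rewrite vdotDr vdotZr !vdot_basisv exprDn mulr_suml; apply: eq_bigr => l _.
    by rewrite exprMn -mulr_natl; ring.
  have s0 : 0 <= 1 + b ^+ 2 by rewrite addr_ge0// sqr_ge0.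
  rewrite (moment_rotate _ (w := scalev (Num.sqrt (1 + b ^+ 2)) (basisv i0))); last first.
    by rewrite vdotZl vdotZr mulrA -expr2 sqr_sqrtr// vv vdot_basisv tnth_mktuple eqxx mulr1.
  rewrite /mom2 mulrC /moment -bmeas_RintegralZ; last exact: bmeas_sphere_vdot.
  apply: eq_Rintegral => x _.
  by rewrite vdotZr exprMn exprM sqr_sqrtr// mulrA.
have := congr1 (fun q : {poly R} => q`_2) pE.
rewrite /= coefZ coef2_pow_1X2 coef_poly.
rewrite ltnS mulnS leq_addr.
rewrite /mm mulnS addnC addnK.
move=> h.
have k1 : (k.+1%:R : R) != 0 by rewrite pnatr_eq0.
apply: (mulfI k1).
rewrite [RHS]mulrC -h mulrA; congr (_ * _).
(* C(2k+2, 2) = (k+1)(2k+1), and the coefficient of b^2 in (1 + b^2)^(k+1) is k+1, so the quotient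
   is 2k+1. *)
rewrite -natrM bin2.
suff -> : ((2 * k + 2) * (2 * k + 2).-1 = (k.+1 * (2 * k).+1).*2)%N by rewrite doubleK.
by rewrite addn2 -mul2n mulnA; congr (_ * _)%N; lia.
Qed.

(** On the sphere the x_j^2 with j != 0 add up to 1 - x_0^2. Weighting by x_0^(2k) and using
    [mixed_moment] for each of the n - 1 terms gives (n - 1) M_(k+1) = (2k+1) (M_k - M_(k+1)). *)
Lemma mom2_rec k : mom2 k.+1 * (n + 2 * k)%:R = (2 * k).+1%:R * mom2 k.
Proof.
set i0 := Ordinal n0.
have : \sum_(j < n | j != i0) \int[P]_x (tnth x i0 ^+ (2 * k) * tnth x j ^+ 2 * \1_sphere x)
   = mom2 k - mom2 k.+1.
  have bm j : bounded_measurable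
     (fun x : vec R n => tnth x i0 ^+ (2 * k) * tnth x j ^+ 2 * \1_sphere x : R).
    exact: bmeas_sphere_monomial.
  have := bmeas_Rintegral_sum P (index_enum 'I_n) bm.
  rewrite (bigD1 i0)//= => /esym/(canRL (addKr _)) ->.
  rewrite addrC; congr (_ - _); rewrite /mom2 /moment; apply: eq_Rintegral => x _.
    rewrite -mulr_suml -mulr_sumr vdot_basisv -/i0 indicE.
    case: (boolP (_ \in _)) => [/set_mem|]; last by rewrite !mulr0.
    rewrite /sphere/= => x1.
    rewrite (eq_bigr (fun i => tnth x i * tnth x i)); last by move=> i _; rewrite expr2.
    by rewrite -/(vdot x x) x1 !mulr1.
  by rewrite vdot_basisv -/i0 -exprD addnC -mulnS.
move/(congr1 (fun r => (2 * k).+1%:R * r)); rewrite mulr_sumr.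
rewrite (eq_bigr (fun=> mom2 k.+1)); last by move=> j ji; exact: mixed_moment.
rewrite sumr_const (_ : #|_| = n.-1); last first.
  by rewrite cardC1 card_ord.
rewrite -[_ *+ n.-1]mulr_natl mulrBr => /esym/eqP; rewrite subr_eq => /eqP ->.
rewrite -mulrDl -natrD mulrC; congr (_%:R * _); move: n0; lia.
Qed.

End spherical_moments.

(** * Negative moments of the overlap *)

Section negative_binomial_series.
Variable R : realType.
Implicit Types (u L : R) (m K : nat).

(** Partial sums of (1 - u)^(-m). The truncated predecessor makes m = 0 come out right: the
    coefficient is 1 at k = 0 and C(k-1, k) = 0 afterwards. *)
Definition negbin m K u : R := \sum_(k < K) 'C((m + k).-1, k)%:R * u ^+ k.

Lemma negbin_nondecreasing m u : 0 <= u ->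
  nondecreasing_seq (fun K => negbin m K u).
Proof.
move=> u0; apply/nondecreasing_seqP => K.
by rewrite /negbin big_ord_recr/= lerDl mulr_ge0// exprn_ge0.
Qed.

(** Pascal's rule on the coefficients: the truncated form of (1 - u) (1 - u)^(-m-1) = (1 -
    u)^(-m). *)
Lemma negbinS m K u : negbin m.+1 K.+1 u = negbin m K.+1 u + u * negbin m.+1 K u.
Proof.
rewrite /negbin [LHS]big_ord_recl [X in X + _ = _]/= [in RHS]big_ord_recl/=.
rewrite !bin0 -addrA; congr (_ + _); rewrite mulr_sumr -big_split/=.
apply: eq_bigr => k _; rewrite /bump/= add1n !addnS/= binS natrD exprS; ring.
Qed.

(* Summing by parts, the partial sums of order m are bounded by (1 - u) times
   any bound on those of order m + 1; this also forces u <> 1. *)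
Lemma negbin_bound m u L : 0 <= u <= 1 -> (forall K, negbin m K u <= L) ->
  1 <= (1 - u) ^+ m * L.
Proof.
move=> /andP[u0 u1]; elim: m => [|m IH] in L *.
  by move=> /(_ 1%N); rewrite /negbin big_ord1 !expr0 mulr1 mul1r /= bin0.
move=> SL; rewrite exprSr -mulrA; apply: IH => K.
(* The supremum replaces the sum of the series: past an index where the partial sums exceed sup A -
   e, [step] gives at most sup A - u (sup A - e) <= (1 - u) sup A + e. *)
pose A := range (fun K => negbin m.+1 K u).
have ubA : ubound A L by move=> _ [k _ <-].
have supA : has_sup A by split; [exists (negbin m.+1 0 u), 0%N|exists L].
have supL : sup A <= L by apply: ge_sup => //; case: supA.
have step k : negbin m k u <= negbin m.+1 k.+1 u - u * negbin m.+1 k u.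
  by rewrite negbinS addrK; exact: negbin_nondecreasing.
suff h : negbin m K u <= (1 - u) * sup A.
  by apply: le_trans h _; rewrite ler_wpM2l// subr_ge0.
apply/ler_addgt0Pr => e e0.
have [_ [K' _ <-] hK'] := sup_adherent e0 supA.
pose k := maxn K K'.
have h1 : negbin m K u <= negbin m k u by apply: negbin_nondecreasing => //; exact: leq_maxl.
have h2 : negbin m.+1 K' u <= negbin m.+1 k u.
  by apply: negbin_nondecreasing => //; exact: leq_maxr.
have h3 : negbin m.+1 k.+1 u <= sup A by apply: ub_le_sup; [exists L|exists k.+1].
have h4 : u * (sup A - e) <= u * negbin m.+1 k u.
  by rewrite ler_wpM2l// (le_trans _ h2)// ltW.
have h5 : u * e <= e by rewrite ler_piMl// ltW.
by have := step k; lra.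
Qed.

End negative_binomial_series.

Section overlap_moments.
Variables (R : realType) (n : nat) (P : probability (vec R n) R).
Hypothesis n0 : (0 < n)%N.
Hypothesis Pu : uniform_sphere P.
Variable m : nat.
Hypothesis mn : (2 * m + 2 < n)%N.
Local Notation M := (mom2 P n0).

Let a k : R := 'C((m + k).-1, k)%:R * M k.

Let a_ge0 k : 0 <= a k.
Proof. by rewrite mulr_ge0 ?ler0n ?mom2_ge0. Qed.

(** The exact ratio of consecutive terms is (m + k)(2k + 1) / ((k + 1)(n + 2k)). Rounding 2k + 1 up
    to 2k + 2 removes k + 1 and leaves the form that telescopes. *)
Let a_step k : a k.+1 * (n + 2 * k)%:R <= 2 * (m + k)%:R * a k.
Proof.
have k1 : 0 < (k.+1%:R : R) by rewrite ltr0n.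
rewrite -(ler_pM2l k1).
have binE : k.+1%:R * 'C((m + k.+1).-1, k.+1)%:R = (m + k)%:R * 'C((m + k).-1, k)%:R :> R.
  by rewrite addnS /= -!natrM mul_bin_diag.
have := mom2_rec n0 Pu k; move: binE (mom2_ge0 P n0 k); rewrite /a.
move: (M k.+1) (M k) => x y; move: ('C(_, k.+1)%:R) ('C(_, k)%:R) (ler0n R 'C((m + k).-1, k)).
move=> b c c0 binE y0 xE.
have -> : k.+1%:R * (b * x * (n + 2 * k)%:R) = (k.+1%:R * b) * (x * (n + 2 * k)%:R).
  by ring.
rewrite binE xE.
have -> : (m + k)%:R * c * ((2 * k).+1%:R * y) = (2 * k).+1%:R * ((m + k)%:R * c * y).
  by ring.
have -> : k.+1%:R * (2 * (m + k)%:R * (c * y)) = (2 * k.+1)%:R * ((m + k)%:R * c * y).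
  by rewrite natrM; ring.
by rewrite ler_wpM2r ?mulr_ge0// ler_nat; lia.
Qed.

Lemma sum_moments_le K :
  (n%:R - 2 - 2 * m%:R) * (\sum_(k < K) 'C((m + k).-1, k)%:R * M k) <= n%:R - 2.
Proof.
(* The induction needs the boundary term: adding (n - 2 - 2m) a_K leaves - 2(m + K) a_K, and
   [a_step] turns this into the next boundary term - (n + 2K) a_(K+1). At K = 0 both sides
   vanish. *)
suff h : (n%:R - 2 - 2 * m%:R) * (\sum_(k < K) a k) <=
    n%:R - 2 - (n%:R - 2 + 2 * K%:R) * a K.
  apply: le_trans h _; rewrite gerBl mulr_ge0// addr_ge0// subr_ge0 ler_nat; lia.
elim: K => [|K IH].
  rewrite big_ord0 mulr0 /a bin0 (mom2_0 n0 Pu).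
  by rewrite mulr0 addr0 !mulr1 subrr.
rewrite big_ord_recr/= mulrDr.
have := a_step K; rewrite (natrD _ n) (natrD _ m) natrM -[K.+1%:R]natr1 => h.
lra.
Qed.

Lemma Rintegral_negbin_le v K : vdot v v = 1 ->
  (n%:R - 2 - 2 * m%:R) * (\int[P]_x (negbin m K (vdot x v ^+ 2) * \1_(@sphere R n) x))
  <= n%:R - 2.
Proof.
move=> v1; rewrite (_ : \int[P]_x _ = \sum_(k < K) 'C((m + k).-1, k)%:R * M k).
  exact: sum_moments_le.
transitivity (\int[P]_x \sum_(k < K) ('C((m + k).-1, k)%:R *
    (vdot x v ^+ (2 * k) * \1_(@sphere R n) x))).
  apply: eq_Rintegral => x _; rewrite /negbin mulr_suml; apply: eq_bigr => k _.
  by rewrite exprM mulrA.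
rewrite bmeas_Rintegral_sum; last by move=> k; apply: bmeasZ; exact: bmeas_sphere_vdot.
apply: eq_bigr => k _; rewrite bmeas_RintegralZ; last exact: bmeas_sphere_vdot.
by rewrite -(moment_unit n0 Pu k v1).
Qed.

(** F is dominated by B (1 - t^2)^(-m), whose series is integrated by monotone convergence. The
    domination is written as a product so that it makes sense at |t| = 1. *)
Lemma overlap_integral_le v (F : R -> R) (B : R) : vdot v v = 1 -> 0 < B ->
  (forall t, 0 <= F t) ->
  bounded_measurable (fun x : vec R n => F (vdot x v) * \1_(@sphere R n) x) ->
  (forall t, `|t| <= 1 -> F t * (1 - t ^+ 2) ^+ m <= B) ->
  (n%:R - 2 - 2 * m%:R) * (\int[P]_x (F (vdot x v) * \1_(@sphere R n) x))
  <= B * (n%:R - 2).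
Proof.
move=> v1 B0 F0 bF FB; have B0' := ltW B0.
have c0 : 0 < n%:R - 2 - 2 * m%:R :> R.
  by move: mn; rewrite -(ltr_nat R) natrD natrM; lra.
pose g K x := (negbin m K (vdot x v ^+ 2) * \1_(@sphere R n) x)%:E : \bar R.
have bg K : bounded_measurable (fun x => negbin m K (vdot x v ^+ 2) * \1_(@sphere R n) x).
  rewrite (_ : (fun x => _) = fun x => \sum_(k < K) ('C((m + k).-1, k)%:R *
      (vdot x v ^+ (2 * k) * \1_(@sphere R n) x))).
    by apply: bmeas_sum => k; apply: bmeasZ; exact: bmeas_sphere_vdot.
  apply/funext => x; rewrite /negbin mulr_suml; apply: eq_bigr => k _.
  by rewrite exprM mulrA.
have g0 K x : (0 <= g K x)%E.
  rewrite lee_fin mulr_ge0 ?indicE ?ler0n// sumr_ge0// => k _.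
  by rewrite mulr_ge0 ?ler0n// exprn_ge0// sqr_ge0.
have gnd x : nondecreasing_seq (g ^~ x).
  move=> i j ij; rewrite lee_fin ler_wpM2r ?indicE ?ler0n//.
  by apply: negbin_nondecreasing => //; exact: sqr_ge0.
have mg K : measurable_fun setT (g K) by apply/measurable_EFinP; case: (bg K).
pose b := (n%:R - 2) / (n%:R - 2 - 2 * m%:R) : R.
have gb K : (\int[P]_x g K x <= b%:E)%E.
  rewrite -EFin_Rintegral// lee_fin ler_pdivlMr// mulrC.
  exact: Rintegral_negbin_le.
have mlim : measurable_fun setT (fun x => limn (g ^~ x)).
  apply: (emeasurable_fun_cvg g) => // x _.
  by apply: ereal_nondecreasing_is_cvgn => i j ij; exact: gnd.
have lim0 x : (0 <= limn (g ^~ x))%E.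
  apply: lime_ge; first exact: ereal_nondecreasing_is_cvgn.
  exact: nearW.
have limb : (\int[P]_x (limn (g ^~ x)) <= b%:E)%E.
  rewrite monotone_convergence//.
  apply: lime_le; last by apply: nearW => K; exact: gb.
  apply: ereal_nondecreasing_is_cvgn => i j ij; apply: ge0_le_integral => // x _.
  exact: gnd.
have Flim x : ((F (vdot x v) * \1_(@sphere R n) x)%:E <= B%:E * limn (g ^~ x))%E.
  rewrite [\1__ x]indicE; have [/set_mem xs|_] := boolP (x \in _); last first.
    by rewrite mulr0; apply: mule_ge0; [rewrite lee_fin ltW|exact: lim0].
  rewrite mulr1; set t := vdot x v.
  have t1 : `|t| <= 1.
    by have := normr_vdot_le x v; rewrite v1 xs -mulr2n -[1 *+ 2]/2%:R divff.
  have u01 : 0 <= t ^+ 2 <= 1.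
    by rewrite sqr_ge0/= -[t ^+ 2]ger0_norm ?sqr_ge0// normrX expr_le1.
  have gle K : (g K x <= limn (g ^~ x))%E.
    rewrite (cvg_lim _ (ereal_nondecreasing_cvgn (gnd x)))//.
    by apply: ereal_sup_ubound; exists K.
  (* A finite limit L bounds all partial sums, so [negbin_bound] applies; an infinite one makes the
     bound trivial because B > 0. *)
  move: (lim0 x) gle; case: (limn (g ^~ x)) => [L|_ _|//].
    rewrite lee_fin => L0 gle.
    have SL K : negbin m K (t ^+ 2) <= L.
      by have := gle K; rewrite /g lee_fin indicE mem_set// mulr1.
    have h := negbin_bound u01 SL.
    rewrite -EFinM lee_fin; apply: (@le_trans _ _ (F t * ((1 - t ^+ 2) ^+ m * L))).
      by rewrite ler_peMr.
    by rewrite mulrA ler_wpM2r// FB.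
  by rewrite mulry gtr0_sg// mul1e leey.
rewrite -ler_pdivlMl// mulrA -lee_fin EFin_Rintegral//.
apply: (@le_trans _ _ (\int[P]_x (B%:E * limn (g ^~ x))))%E.
  apply: ge0_le_integral => //.
  - by move=> x _; rewrite lee_fin mulr_ge0 ?indicE ?ler0n.
  - by apply/measurable_EFinP; case: bF.
  - exact: measurable_funeM.
rewrite ge0_integralZl// (@le_trans _ _ (B%:E * b%:E)%E)//.
  by rewrite lee_wpmul2l// lee_fin.
rewrite -EFinM lee_fin /b le_eqVlt; apply/orP; left; apply/eqP.
by field; rewrite gt_eqF.
Qed.

End overlap_moments.

(** * The weight n |t|^3 exp(n c rate) and its vanishing mean *)

Section overlap_weight.
Variable R : realType.
Implicit Types (c l t : R).

Definition rate d t : R := `|t| ^+ d / (1 + `|t| ^+ d).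

Lemma rate_ge0 d t : 0 <= rate d t.
Proof. by rewrite divr_ge0 ?addr_ge0 ?exprn_ge0. Qed.

Lemma rate_le d t : rate d t <= `|t| ^+ d.
Proof.
rewrite ler_pdivrMr ?ltr_wpDr ?exprn_ge0//.
by rewrite ler_peMr ?exprn_ge0// lerDl exprn_ge0.
Qed.

Lemma measurable_rate d : measurable_fun setT (@rate d).
Proof.
have e0 t : 0 < 1 + `|t| ^+ d by rewrite ltr_wpDr ?exprn_ge0.
rewrite (_ : rate d = fun t => `|t| ^+ d * expR (- ln (1 + `|t| ^+ d))).
  have mn : measurable_fun setT (fun t : R => `|t| ^+ d).
    by apply: measurable_funX; exact: normr_measurable.
  apply: measurable_funM => //; apply: measurableT_comp => //.
  apply: measurableT_comp => //; apply: measurableT_comp => //.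
  exact: measurable_funD.
by apply/funext => t; rewrite expRN lnK ?posrE.
Qed.

(** A common majorant: c times it bounds the excess over 1 of the truncated second moment ([G_le]),
    and it also bounds that second moment times t^d ([GX_le]). *)
Definition overlap_weight n c d t : R :=
  n%:R * `|t| ^+ 3 * expR (n%:R * c * rate d t).

Lemma overlap_weight_ge0 n c d t : 0 <= overlap_weight n c d t.
Proof. by rewrite /overlap_weight !mulr_ge0 ?expR_ge0 ?exprn_ge0. Qed.

Lemma measurable_overlap_weight n c d : measurable_fun setT (overlap_weight n c d).
Proof.
apply: measurable_funM.
  apply: measurable_funM => //; apply: measurable_funX; exact: normr_measurable.
apply: measurableT_comp => //; apply: measurable_funM => //; exact: measurable_rate.
Qed.

Lemma overlap_weight_le n c d t : 0 <= c -> `|t| <= 1 ->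
  overlap_weight n c d t <= n%:R * expR (n%:R * c).
Proof.
move=> c0 t1; apply: ler_pM => //.
- by rewrite ler_piMr// exprn_ile1.
- rewrite ler_expR ler_piMr ?mulr_ge0// (le_trans (rate_le _ _))//.
  by rewrite exprn_ile1.
Qed.

Definition admissible d l := forall t, 0 <= t < 1 ->
  l ^+ 2 / 2 * (t ^+ d / (1 + t ^+ d)) <= - (2^-1 * ln (1 - t ^+ 2)).

(** Put w = - ln(1 - t^2) >= t^2. Admissibility gives c rate <= al w / 2, so (1 - t^2)^m absorbs the
    exponential and leaves exp(- et n w). With y = sqrt(n) |t| the prefactor n |t|^3 is y^3 /
    sqrt(n), and the leftover decay beats y^3. *)
Lemma overlap_weight_bound n m c d l al et t : (0 < n)%N -> (0 < m)%N ->
  admissible d l -> 0 < et -> 0 <= al -> c = al * (l ^+ 2 / 2) ->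
  (al / 2 + et) * n%:R <= m%:R -> `|t| <= 1 ->
  overlap_weight n c d t * (1 - t ^+ 2) ^+ m <=
  (1 + 4 / et ^+ 2) / Num.sqrt n%:R.
Proof.
move=> n0 m0 adm e0 al0 cE hm t1.
have N0 : 0 < n%:R :> R by rewrite ltr0n.
have s0 : 0 < Num.sqrt n%:R :> R by rewrite sqrtr_gt0.
have C0 : 0 <= 1 + 4 / et ^+ 2 by rewrite addr_ge0// divr_ge0// exprn_ge0// ltW.
(* Admissibility covers only t < 1; at |t| = 1 the left side vanishes because m > 0. *)
have [t1'|t1'] := eqVneq `|t| 1.
  rewrite -(real_normK (num_real t)) t1' expr1n subrr expr0n -(negbK (m == 0%N)) -lt0n m0.
  by rewrite mulr0 divr_ge0// ltW.
have {t1 t1'} t1 : `|t| < 1 by rewrite lt_neqAle t1' t1.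
have u1 : 0 < 1 - t ^+ 2.
  by rewrite subr_gt0 -(real_normK (num_real t)) expr_lt1.
set w := - ln (1 - t ^+ 2).
have wE : (1 - t ^+ 2) ^+ m = expR (- (m%:R * w)).
  by rewrite /w mulrN opprK expRM_natl lnK// posrE.
have wt : t ^+ 2 <= w.
  by rewrite /w lerNr (@le_ln1Dx _ (- t ^+ 2))//; lra.
have w0 : 0 <= w by apply: le_trans wt; exact: sqr_ge0.
have hr : c * rate d t <= al / 2 * w.
  have := adm `|t|; rewrite normr_ge0 t1 real_normK ?num_real// => /(_ isT).
  move=> /(ler_wpM2l al0) h; rewrite cE -[_ * rate d t]mulrA; apply: (le_trans h).
  by rewrite /w le_eqVlt; apply/orP; left; apply/eqP; field.
pose y := Num.sqrt n%:R * `|t|.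
have y0 : 0 <= y by rewrite mulr_ge0// ltW.
have y2 : y ^+ 2 = n%:R * t ^+ 2.
  by rewrite exprMn sqr_sqrtr ?ltW// real_normK// num_real.
(* From y^3 <= 1 + y^4 and exp(z) = exp(z / 2)^2 >= (z / 2)^2 at z = et n w >= et y^2, whence 4 /
   et^2. *)
have hy : y ^+ 3 <= (1 + 4 / et ^+ 2) * expR (et * n%:R * w).
  have h1 : y ^+ 3 <= 1 + (y ^+ 2) ^+ 2.
    by have := sqr_ge0 (y ^+ 2 - y); have := sqr_ge0 (y - 1);
      have := sqr_ge0 (y * (y - 1)); have := sqr_ge0 (y ^+ 2); nra.
  apply: (le_trans h1); rewrite mulrDl mul1r; apply: lerD.
    by rewrite -expR0 ler_expR !mulr_ge0// ltW.
  rewrite mulrAC ler_pdivlMr ?exprn_gt0// -exprMn.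
  have -> : et * n%:R * w = 2%:R * (et * n%:R * w / 2) by field.
  rewrite expRM_natl (_ : 4 = 2 ^+ 2 :> R); last by ring.
  rewrite -exprMn ler_sqr ?nnegrE.
  - rewrite -ler_pdivrMl// (le_trans _ (expR_ge1Dx _))// y2.
    have : n%:R * t ^+ 2 * et <= n%:R * w * et by rewrite ler_wpM2r ?ler_wpM2l// ltW.
    lra.
  - by rewrite mulr_ge0 ?exprn_ge0// ltW.
  - by rewrite mulr_ge0 ?expR_ge0.
rewrite ler_pdivlMr// /overlap_weight wE.
have -> : n%:R * `|t| ^+ 3 * expR (n%:R * c * rate d t) * expR (- (m%:R * w)) *
    Num.sqrt n%:R = y ^+ 3 * expR (n%:R * c * rate d t - m%:R * w).
  rewrite expRD /y exprMn (exprSr (Num.sqrt _)) sqr_sqrtr ?ltW//; ring.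
apply: (@le_trans _ _ ((1 + 4 / et ^+ 2) * expR (et * n%:R * w) *
    expR (n%:R * c * rate d t - m%:R * w))).
  by rewrite ler_wpM2r ?expR_ge0.
rewrite -mulrA -expRD ler_piMr// -[leRHS]expR0 ler_expR.
have h1 : n%:R * (c * rate d t) <= n%:R * (al / 2 * w) by rewrite ler_wpM2l.
have h2 : (al / 2 + et) * n%:R * w <= m%:R * w by rewrite ler_wpM2r.
lra.
Qed.

Lemma bmeas_overlap_weight n c d (v : vec R n) : 0 <= c -> vdot v v = 1 ->
  bounded_measurable
    (fun x : vec R n => overlap_weight n c d (vdot x v) * \1_(@sphere R n) x).
Proof.
move=> c0 v1; split.
  apply: measurable_funM; last exact: measurable_indic (@measurable_sphere R n).
  apply: measurableT_comp; first exact: measurable_overlap_weight.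
  by apply: measurable_vdot => //; exact: measurable_id.
exists (n%:R * expR (n%:R * c)) => x; rewrite indicE.
have [/set_mem xs|_] := boolP (x \in _).
  rewrite mulr1 ger0_norm ?overlap_weight_ge0// overlap_weight_le//.
  by have := normr_vdot_le x v; rewrite v1 xs -mulr2n -[1 *+ 2]/2%:R divff.
by rewrite mulr0 normr0 mulr_ge0// expR_ge0.
Qed.

Lemma overlap_vanishes d c l : admissible d l -> 0 <= c -> c < l ^+ 2 / 2 ->
  forall eps, 0 < eps -> exists n1 : nat, forall n, (n1 <= n)%N -> (0 < n)%N ->
  forall P : probability (vec R n) R, uniform_sphere P ->
  forall v : vec R n, vdot v v = 1 ->
  \int[P]_x (overlap_weight n c d (vdot x v) * \1_(@sphere R n) x) <= eps.
Proof.
move=> adm c0 cl eps e0.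
have l0 : 0 < l ^+ 2 / 2 by exact: le_lt_trans cl.
pose al := c / (l ^+ 2 / 2).
have al0 : 0 <= al by rewrite divr_ge0// ltW.
have al1 : al < 1 by rewrite ltr_pdivrMr// mul1r.
have cE : c = al * (l ^+ 2 / 2) by rewrite divfK// gt_eqF.
(* The exponent aims at q = (1 + al) n / 4, halfway between al n / 2, used up by the exponential
   weight, and n / 2, the limit of the moment bound. Then (al / 2 + et) n = q - et n with et n > 1,
   which pays for rounding q down to m, and n - 2 - 2m >= 4 et n - 2 >= 2 et n. *)
pose et := (1 - al) / 8.
have et0 : 0 < et by rewrite /et; lra.
pose C := 1 + 4 / et ^+ 2.
have C0 : 0 < C by rewrite ltr_wpDr// divr_ge0// exprn_ge0// ltW.
pose b := C / (2 * et * eps).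
have b0 : 0 < b by apply: divr_gt0 => //; apply: mulr_gt0 => //; apply: mulr_gt0.
(* The first threshold ensures et n > 1, the second C / (2 et sqrt(n)) <= eps, which is the final
   bound on the integral. *)
exists (maxn (Num.truncn (1 / et)).+1 (Num.truncn (b ^+ 2)).+1) => n.
rewrite geq_max => /andP[n1 n2] n0 P Pu v v1.
have hn1 : 1 / et < n%:R by apply: lt_le_trans (truncnS_gt _) _; rewrite ler_nat.
have hn2 : b ^+ 2 < n%:R by apply: lt_le_trans (truncnS_gt _) _; rewrite ler_nat.
have N0 : 0 < n%:R :> R by rewrite ltr0n.
have hne : 1 < et * n%:R by rewrite mulrC -ltr_pdivrMr.
have s0 : 0 < Num.sqrt n%:R :> R by rewrite sqrtr_gt0.
have hs : b <= Num.sqrt n%:R.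
  by rewrite -[b]ger0_norm ?(ltW b0)// -sqrtr_sqr ler_wsqrtr// ltW.
pose q := (1 + al) / 4 * n%:R.
have q0 : 0 <= q by rewrite /q !mulr_ge0//; lra.
pose m := Num.truncn q.
have mq : m%:R <= q by rewrite truncn_le.
have qm : q < m%:R + 1 by rewrite natr1 truncnS_gt.
have hm : (al / 2 + et) * n%:R <= m%:R.
  have : et * n%:R = (1 - al) / 8 * n%:R by [].
  rewrite /q in qm mq; lra.
have m0 : (0 < m)%N.
  rewrite -(ltr_nat R); apply: lt_le_trans hm; rewrite mulr_gt0//; lra.
have gap : 2 * et * n%:R <= n%:R - 2 - 2 * m%:R.
  have : et * n%:R = (1 - al) / 8 * n%:R by [].
  rewrite /q in qm mq; lra.
have mn : (2 * m + 2 < n)%N.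
  rewrite -(ltr_nat R) natrD natrM; lra.
have B0 : 0 < C / Num.sqrt n%:R by rewrite divr_gt0.
have := @overlap_integral_le R n P n0 Pu m mn v (overlap_weight n c d) _ v1 B0.
move=> /(_ (fun t => overlap_weight_ge0 n c d t) (bmeas_overlap_weight d c0 v1)).
have FB t : `|t| <= 1 -> overlap_weight n c d t * (1 - t ^+ 2) ^+ m <= C / Num.sqrt n%:R.
  exact: (overlap_weight_bound n0 m0 adm et0 al0 cE hm).
move=> /(_ FB).
set I := \int[_]_x _ => h.
have I0 : 0 <= I.
  by apply: Rintegral_ge0 => x _; rewrite mulr_ge0 ?overlap_weight_ge0.
have h1 : 2 * et * n%:R * I <= C / Num.sqrt n%:R * n%:R.
  apply: le_trans (_ : _ <= (n%:R - 2 - 2 * m%:R) * I) _; first by rewrite ler_wpM2r.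
  by apply: le_trans h _; rewrite ler_wpM2l ?(ltW B0)//; lra.
have h2 : 2 * et * I <= C / Num.sqrt n%:R.
  by rewrite -(ler_pM2r N0) mulrAC.
have h3 : C / Num.sqrt n%:R <= 2 * et * eps.
  have d0 : 0 < 2 * et * eps by apply: mulr_gt0 => //; exact: mulr_gt0.
  by rewrite ler_pdivrMr// -ler_pdivrMl// mulrC.
have e2 : 0 < 2 * et by rewrite mulr_gt0.
by rewrite -(ler_pM2l e2) (le_trans h2).
Qed.

End overlap_weight.

(** * Second moments *)

Section second_moment.
Variables (R : realType) (d n : nat) (lam del : R).
Hypotheses (d3 : (3 <= d)%N) (n0 : (0 < n)%N) (lam0 : 0 <= lam) (del0 : 0 <= del).
Variable P : probability (vec R n) R.
Hypothesis Pu : uniform_sphere P.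
Local Notation T := (tensor R d n).
Local Notation Q := (noise R d n).
Local Notation lik := (@trunc_lik R d n lam del).
Local Notation S := (@sphere R n).
Local Notation c := (lam ^+ 2 / 2 + lam * del).
Local Notation tail := (expR (- (n%:R * del ^+ 2 / 4))).

Let c0 : 0 <= c. Proof. by rewrite addr_ge0 ?divr_ge0 ?sqr_ge0 ?mulr_ge0. Qed.

Let blik : bounded_measurable lik. Proof. exact: bmeas_trunc_lik. Qed.
Let bS : bounded_measurable (\1_S : vec R n -> R).
Proof. exact: bmeas_indic (@measurable_sphere R n). Qed.

Lemma bmeas_fst d1 d2 (T1 : measurableType d1) (T2 : measurableType d2)
  (f : T1 -> R) : bounded_measurable f ->
  bounded_measurable (fun p : T1 * T2 => f p.1).
Proof.
by move=> [mf [C fC]]; split; [exact: measurableT_comp|exists C].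
Qed.

Lemma bmeas_snd d1 d2 (T1 : measurableType d1) (T2 : measurableType d2)
  (f : T2 -> R) : bounded_measurable f ->
  bounded_measurable (fun p : T1 * T2 => f p.2).
Proof.
by move=> [mf [C fC]]; split; [exact: measurableT_comp|exists C].
Qed.

Lemma bmeas_comp d1 d2 (T1 : measurableType d1) (T2 : measurableType d2)
  (f : T2 -> R) (g : T1 -> T2) : bounded_measurable f ->
  measurable_fun setT g -> bounded_measurable (f \o g).
Proof.
by move=> [mf [C fC]] mg; split; [exact: measurableT_comp|exists C => x; exact: fC].
Qed.

(** With f the indicator of the sphere this is the truncated likelihood ratio averaged over the
    prior; with f a coordinate of x^(tensor d) it is an unnormalised posterior mean. *)
Definition projection (f : vec R n -> R) (W : T) : R :=
  \int[P]_x (f x * lik (x, W)).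

Lemma bmeas_feature_lik f : bounded_measurable f ->
  bounded_measurable (fun p : vec R n * T => f p.1 * lik p).
Proof. by move=> bf; apply: bmeasM => //; exact: bmeas_fst. Qed.

Lemma bmeas_projection f : bounded_measurable f ->
  bounded_measurable (projection f).
Proof.
by move=> bf; exact: (bmeas_Rintegralr P Q (bmeas_feature_lik bf)).
Qed.

(** The square of an average over x is an average over two independent spikes x and y; Fubini then
    moves the noise integral inside. *)
Lemma Rintegral_projection2 f : bounded_measurable f ->
  \int[Q]_W projection f W ^+ 2 =
  \int[P]_y \int[P]_x (f x * f y * \int[Q]_W (lik (x, W) * lik (y, W))).
Proof.
move=> bf.
have bh := bmeas_feature_lik bf.
pose h (p : vec R n * T) := f p.1 * lik p.
pose k (p : (vec R n * T) * vec R n) := h (p.2, p.1.2) * h p.1.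
have bk : bounded_measurable k.
  apply: bmeasM; last exact: bmeas_fst.
  apply: (bmeas_comp (g := fun p : (vec R n * T) * vec R n => (p.2, p.1.2)) bh).
  apply: measurable_fun_pair => //.
  exact: measurableT_comp measurable_snd measurable_fst.
transitivity (\int[Q]_W \int[P]_y \int[P]_x k ((y, W), x)).
  apply: eq_Rintegral => W _; rewrite expr2 {2}/projection.
  rewrite -bmeas_RintegralZ; last exact: (bmeas_pairr bh W).
  apply: eq_Rintegral => y _; rewrite /projection mulrC.
  rewrite -bmeas_RintegralZ; last exact: (bmeas_pairr bh W).
  by apply: eq_Rintegral => x _; rewrite /k /h/= mulrC.
rewrite -(Rintegral_swap P Q (bmeas_Rintegrall (P \x Q)%E P bk)).
apply: eq_Rintegral => y _.
have bky : bounded_measurable (fun p : T * vec R n => k ((y, p.1), p.2)).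
  apply: (bmeas_comp bk); apply: measurable_fun_pair => //.
  by apply: measurable_fun_pair => //.
rewrite (Rintegral_swap Q P bky).
apply: eq_Rintegral => x _.
rewrite -bmeas_RintegralZ; last first.
  by apply: bmeasM; exact: (bmeas_pairl blik).
by apply: eq_Rintegral => W _; rewrite /k /h/=; ring.
Qed.

Let G x y : R := \int[Q]_W (lik (x, W) * lik (y, W)).

Lemma overlap_le1 x y : S x -> S y -> `|vdot x y| <= 1.
Proof.
rewrite /sphere/= => x1 y1; have := normr_vdot_le x y.
by rewrite x1 y1 -mulr2n -[1 *+ 2]/2%:R divff.
Qed.

Lemma G_ge0 x y : 0 <= G x y.
Proof. by apply: Rintegral_ge0 => W _; rewrite mulr_ge0// trunc_lik_ge0. Qed.

Lemma G_le x y : S x -> S y -> G x y <= 1 + c * overlap_weight n c d (vdot x y).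
Proof.
move=> Sx Sy; rewrite /G; apply: (le_trans (Rintegral_trunc_lik2_le d n0 lam0 del0 Sx Sy)).
rewrite -/(rate d (vdot x y)); set t := vdot x y; set Y := n%:R * c * rate d t.
have t1 : `|t| <= 1 by exact: overlap_le1.
(* Multiplying 1 - Y <= exp(- Y) by exp(Y). The factor Y supplies n |t|^3, since rate <= |t|^d <=
   |t|^3. *)
apply: (@le_trans _ _ (1 + Y * expR Y)).
  have := expR_ge1Dx (- Y); rewrite -(ler_pM2r (expR_gt0 Y)) -expRD addNr expR0.
  lra.
have Yle : Y <= c * (n%:R * `|t| ^+ 3).
  rewrite /Y (_ : _ * rate d t = c * (n%:R * rate d t)); last by ring.
  apply: ler_wpM2l => //; apply: ler_wpM2l => //.
  by rewrite (le_trans (rate_le _ _))// ler_wiXn2l.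
by rewrite lerD2l /overlap_weight -/Y [leRHS]mulrA ler_wpM2r ?expR_ge0.
Qed.

Lemma GX_le x y : S x -> S y ->
  vdot x y ^+ d * G x y <= overlap_weight n c d (vdot x y).
Proof.
move=> Sx Sy.
have t1 : `|vdot x y| <= 1 by exact: overlap_le1.
apply: (@le_trans _ _ (`|vdot x y| ^+ d * G x y)).
  by rewrite ler_wpM2r ?G_ge0// -normrX ler_norm.
rewrite /overlap_weight; apply: ler_pM; rewrite ?exprn_ge0 ?G_ge0//.
  apply: (@le_trans _ _ (`|vdot x y| ^+ 3)); first by rewrite ler_wiXn2l.
  by rewrite ler_peMl ?exprn_ge0// ler1n.
exact: Rintegral_trunc_lik2_le.
Qed.

Variable eps : R.
Hypothesis eps0 : 0 <= eps.
Hypothesis overlap_le : forall v : vec R n, vdot v v = 1 ->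
  \int[P]_x (overlap_weight n c d (vdot x v) * \1_S x) <= eps.

Lemma bmeas_G2 : bounded_measurable (fun p : vec R n * vec R n => G p.1 p.2).
Proof.
pose k (p : (vec R n * vec R n) * T) := lik (p.1.1, p.2) * lik (p.1.2, p.2).
have bk : bounded_measurable k.
  apply: bmeasM.
    apply: (bmeas_comp (g := fun p : (vec R n * vec R n) * T => (p.1.1, p.2)) blik).
    apply: measurable_fun_pair => //; exact: measurableT_comp measurable_fst measurable_fst.
  apply: (bmeas_comp (g := fun p : (vec R n * vec R n) * T => (p.1.2, p.2)) blik).
  apply: measurable_fun_pair => //; exact: measurableT_comp measurable_snd measurable_fst.
have := bmeas_Rintegrall (P \x P)%E Q bk.
by congr bounded_measurable; apply/funext => -[].
Qed.

Lemma bmeas_kernel f : bounded_measurable f ->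
  bounded_measurable (fun p : vec R n * vec R n => f p.1 * f p.2 * G p.1 p.2).
Proof.
move=> bf; apply: bmeasM; last exact: bmeas_G2.
by apply: bmeasM; [exact: bmeas_fst|exact: bmeas_snd].
Qed.

Lemma Rintegral_sphere : \int[P]_x \1_S x = 1.
Proof.
rewrite -[RHS](Rintegral_prob_cst P 1).
rewrite [RHS](Rintegral_full (@measurable_sphere R n) (sphere_full Pu))//.
by apply: eq_Rintegral => x _; rewrite mul1r.
Qed.

Lemma projection1_ge : 1 - tail <= \int[Q]_W projection \1_S W.
Proof.
rewrite /projection -(Rintegral_swap P Q (bmeas_feature_lik bS)).
rewrite -[leLHS](Rintegral_prob_cst P).
apply: (le_Rintegral_full (@measurable_sphere R n) (sphere_full Pu)).
- exact: bmeas_cst.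
- exact: (bmeas_Rintegrall P Q (bmeas_feature_lik bS)).
- move=> x Sx; rewrite (@eq_Rintegral _ _ _ Q setT (fun W => lik (x, W))).
    exact: Rintegral_trunc_lik_ge.
  by move=> W _; rewrite indicE/= mem_set// mul1r.
Qed.

Lemma projection1_sqr_le : \int[Q]_W projection \1_S W ^+ 2 <= 1 + c * eps.
Proof.
rewrite Rintegral_projection2// -[leRHS](Rintegral_prob_cst P).
have bk := bmeas_kernel bS.
apply: bmeas_le_Rintegral.
- exact: (bmeas_Rintegralr P P bk).
- exact: bmeas_cst.
- move=> y; have [/set_mem Sy|yS] := boolP (y \in S); last first.
    under eq_Rintegral do rewrite [\1__ y]indicE (negPf yS) mulr0 mul0r.
    by rewrite Rintegral_prob_cst addr_ge0// mulr_ge0.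
  have bo := bmeas_overlap_weight d c0 Sy.
  apply: (@le_trans _ _ (\int[P]_x (\1_S x + c *
      (overlap_weight n c d (vdot x y) * \1_S x)))).
    apply: bmeas_le_Rintegral.
    + exact: (bmeas_pairr bk y).
    + by apply: bmeasD => //; exact: bmeasZ.
    + move=> x; rewrite [\1__ y]indicE mem_set// !indicE.
      have [/set_mem Sx|_] := boolP (x \in S); last by rewrite !(mul0r, mulr0) addr0.
      by rewrite !mul1r mulr1 G_le.
  rewrite bmeas_RintegralD//; last exact: bmeasZ.
  by rewrite Rintegral_sphere lerD2l bmeas_RintegralZ// ler_wpM2l// overlap_le.
Qed.

(** Summing over coordinates first turns the products of features into <x, y>^d by [vdot_rank1], so
    the number of coordinates n^d does not enter the bound. *)
Lemma projection_feature_sqr_le :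
  \int[Q]_W (\sum_k projection (fun x => \1_S x * tnth (rank1 d x) k) W ^+ 2) <= eps.
Proof.
pose f k x : R := \1_S x * tnth (rank1 d x) k.
have bf k : bounded_measurable (f k).
  split.
    apply: measurable_funM; first exact: measurable_indic (@measurable_sphere R n).
    exact: measurableT_comp (measurable_tnth k) (@measurable_rank1 R d n).
  exists 1 => x; rewrite /f indicE; have [/set_mem Sx|_] := boolP (x \in S); last first.
    by rewrite mul0r normr0.
  rewrite mul1r tnth_mktuple normr_prod; apply: prodr_ile1 => i.
  by rewrite normr_ge0 normr_tnth_le1.
rewrite bmeas_Rintegral_sum; last by move=> k; apply: bmeasX; exact: (bmeas_projection (bf k)).
under eq_bigr do rewrite (Rintegral_projection2 (bf _)).
have bk k := bmeas_kernel (bf k).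
rewrite -bmeas_Rintegral_sum; last by move=> k; exact: (bmeas_Rintegralr P P (bk k)).
rewrite -[leRHS](Rintegral_prob_cst P).
apply: bmeas_le_Rintegral.
- by apply: bmeas_sum => k; exact: (bmeas_Rintegralr P P (bk k)).
- exact: bmeas_cst.
- move=> y; rewrite -bmeas_Rintegral_sum; last by move=> k; exact: (bmeas_pairr (bk k) y).
  have [/set_mem Sy|yS] := boolP (y \in S); last first.
    rewrite (@eq_Rintegral _ _ _ P setT (fun=> 0)) ?Rintegral_prob_cst// => x _.
    by apply: big1 => k _; rewrite /f [\1__ y]indicE (negPf yS) mul0r mulr0 mul0r.
  have bo := bmeas_overlap_weight d c0 Sy.
  apply: le_trans (overlap_le Sy); apply: bmeas_le_Rintegral => //.
    by apply: bmeas_sum => k; exact: (bmeas_pairr (bk k) y).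
  move=> x; rewrite -mulr_suml.
  have -> : \sum_k f k x * f k y = \1_S x * vdot x y ^+ d.
    rewrite -vdot_rank1 mulr_sumr; apply: eq_bigr => k _.
    by rewrite /f [\1__ y]indicE mem_set// mul1r mulrA.
  rewrite -mulrA mulrC; rewrite indicE.
  have [/set_mem Sx|_] := boolP (x \in S); last by rewrite !mulr0.
  by rewrite !mulr1 GX_le.
Qed.

End second_moment.

(** * Planted against null *)

Section planted_versus_null.
Variables (R : realType) (d n : nat) (lam del : R).
Hypotheses (d3 : (3 <= d)%N) (n0 : (0 < n)%N) (lam0 : 0 <= lam) (del0 : 0 <= del).
Variable P : probability (vec R n) R.
Hypothesis Pu : uniform_sphere P.
Local Notation T := (tensor R d n).
Local Notation Q := (noise R d n).
Local Notation lik := (@trunc_lik R d n lam del).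
Local Notation S := (@sphere R n).
Local Notation c := (lam ^+ 2 / 2 + lam * del).
Local Notation tail := (expR (- (n%:R * del ^+ 2 / 4))).
Local Notation plant x := (addv (scalev lam (rank1 d x))).

Let blik : bounded_measurable lik. Proof. exact: bmeas_trunc_lik. Qed.
Let bS : bounded_measurable (\1_S : vec R n -> R).
Proof. exact: bmeas_indic (@measurable_sphere R n). Qed.

Lemma measurable_plant :
  measurable_fun setT (fun p : vec R n * T => plant p.1 p.2).
Proof.
apply/measurable_fun_tnthP => i.
rewrite (_ : _ \o _ = fun p : vec R n * T => lam * tnth (rank1 d p.1) i + tnth p.2 i).
  apply: measurable_funD.
    apply: measurable_funM => //.
    apply: (measurableT_comp (measurable_tnth i)).
    exact: measurableT_comp (@measurable_rank1 R d n) measurable_fst.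
  exact: measurableT_comp (measurable_tnth i) measurable_snd.
by apply/funext => p /=; rewrite !tnth_mktuple.
Qed.

(** On the typical event this is the change of measure; the atypical planted event has probability
    at most [tail], and |g| <= 1 there. *)
Lemma planted_le x (g : T -> R) : S x -> measurable_fun setT g ->
  (forall W, `|g W| <= 1) ->
  \int[Q]_W g (plant x W) <= \int[Q]_W (g W * lik (x, W)) + tail.
Proof.
move=> Sx mg g1.
have bg : bounded_measurable g by split=> //; exists 1.
have mp := @measurable_addv R _ (scalev lam (rank1 d x)).
have bgp : bounded_measurable (fun W => g (plant x W)).
  exact: (bmeas_comp bg mp).
have bt : bounded_measurable (fun W => \1_(@typical R d n lam del) (x, plant x W) : R).
  apply: (bmeas_comp (f := \1_(@typical R d n lam del)) (g := fun W => (x, plant x W))).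
    exact: bmeas_indic (@measurable_typical R d n lam del).
  exact: measurable_fun_pair.
rewrite -(Rintegral_planted lam del n0 Sx mg).
have h := Rintegral_trunc_lik_ge d lam n0 del0 Sx.
apply: (@le_trans _ _ (\int[Q]_W (g (plant x W) * \1_(@typical R d n lam del) (x, plant x W)) +
    (1 - \int[Q]_W lik (x, W)))); last by lra.
under [X in _ - X]eq_Rintegral do rewrite -[lik _]mul1r.
rewrite -(Rintegral_planted lam del n0 Sx (@measurable_cst _ _ _ _ setT (1 : R))).
rewrite -[X in X - _](Rintegral_prob_cst Q 1) -[- \int[_]_x _]mulN1r.
have bt1 : bounded_measurable (fun W => 1 * \1_(@typical R d n lam del) (x, plant x W) : R).
  exact: bmeasZ.
rewrite -bmeas_RintegralZ// -!bmeas_RintegralD//.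
- apply: bmeas_le_Rintegral => //.
  + apply: bmeasD; first exact: bmeasM.
    by apply: bmeasD; [exact: bmeas_cst|exact: bmeasZ].
  + move=> W; rewrite mul1r indicE; case: (_ \in _); rewrite ?mulr1 ?mulr0/=.
      by rewrite subrr addr0.
    by rewrite addr0 add0r (le_trans (ler_norm _)).
- exact: bmeasM.
- by apply: bmeasD; [exact: bmeas_cst|exact: bmeasZ].
- exact: bmeas_cst.
- exact: bmeasZ.
Qed.

Lemma Rintegral_planted_le (g : vec R n * T -> R) : bounded_measurable g ->
  (forall x W, S x -> `|g (x, W)| <= 1) ->
  \int[P]_x \int[Q]_W g (x, plant x W) <=
  \int[Q]_W \int[P]_x (\1_S x * g (x, W) * lik (x, W)) + tail.
Proof.
move=> bg g1.
have bgp : bounded_measurable (fun p : vec R n * T => g (p.1, plant p.1 p.2)).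
  apply: (bmeas_comp bg); apply: measurable_fun_pair => //; exact: measurable_plant.
have bh : bounded_measurable (fun p : vec R n * T => \1_S p.1 * g p * lik p).
  by apply: bmeasM => //; apply: bmeasM => //; exact: bmeas_fst.
have bh' : bounded_measurable
    (fun p : vec R n * T => \1_S p.1 * g (p.1, p.2) * lik (p.1, p.2)).
  by move: bh; congr bounded_measurable; apply/funext => -[].
rewrite -(Rintegral_swap P Q bh') -[X in _ + X](Rintegral_prob_cst P).
rewrite -bmeas_RintegralD; last 2 first.
- exact: (bmeas_Rintegrall P Q bh').
- exact: bmeas_cst.
apply: (le_Rintegral_full (@measurable_sphere R n) (sphere_full Pu)).
- exact: (bmeas_Rintegrall P Q bgp).
- by apply: bmeasD; [exact: (bmeas_Rintegrall P Q bh')|exact: bmeas_cst].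
move=> x Sx.
apply: (le_trans (planted_le (g := fun W => g (x, W)) Sx _ _)).
- by case: (bmeas_pairl bg x).
- by move=> W; exact: g1.
rewrite lerD2r le_eqVlt; apply/orP; left; apply/eqP; apply: eq_Rintegral => W _.
by rewrite /= indicE mem_set// mul1r.
Qed.

Variable eps : R.
Hypothesis eps0 : 0 <= eps.
Hypothesis overlap_le : forall v : vec R n, vdot v v = 1 ->
  \int[P]_x (overlap_weight n c d (vdot x v) * \1_S x) <= eps.

(** With L the averaged truncated ratio, the advantage is at most E|L - 1|, and |u| <= k + u^2 /
    (4k) replaces Cauchy-Schwarz. Lower bound on E L and upper bound on E L^2 give E(L - 1)^2 <= c
    eps + 2 tail. *)
Lemma test_le (psi : T -> R) (k : R) : 0 < k -> measurable_fun setT psi ->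
  (forall W, 0 <= psi W <= 1) ->
  \int[P]_x \int[Q]_W psi (plant x W) <=
  \int[Q]_W psi W + k + (c * eps + 2 * tail) / (4 * k) + tail.
Proof.
move=> k0 mpsi psi01.
have psi1 W : `|psi W| <= 1 by have /andP[p0 p1] := psi01 W; rewrite ger0_norm.
have bpsi : bounded_measurable psi by split=> //; exists 1.
have := @Rintegral_planted_le (fun p => psi p.2) (bmeas_snd _ bpsi).
move=> /(_ (fun x W _ => psi1 W)) /le_trans; apply; rewrite lerD2r.
pose L : T -> R := projection lam del P \1_S.
have bL : bounded_measurable L by exact: bmeas_projection.
apply: (@le_trans _ _ (\int[Q]_W (psi W + (k + (4 * k)^-1 * (L W ^+ 2 + ((-2) * L W + 1)))))).
  apply: bmeas_le_Rintegral.
  - apply: (bmeas_Rintegralr P Q (f := fun p : vec R n * T => \1_S p.1 * psi p.2 * lik (p.1, p.2))).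
    apply: bmeasM; last first.
      by move: blik; congr bounded_measurable; apply/funext => -[].
    by apply: bmeasM; [exact: bmeas_fst|exact: bmeas_snd].
  - apply: bmeasD => //; apply: bmeasD; first exact: bmeas_cst.
    apply: bmeasZ; apply: bmeasD; first exact: bmeasX.
    by apply: bmeasD; [exact: bmeasZ|exact: bmeas_cst].
  - move=> W.
    have -> : \int[P]_x (\1_S x * psi W * lik (x, W)) = psi W * L W.
      rewrite /L /projection -bmeas_RintegralZ; last first.
        by apply: bmeasM => //; exact: (bmeas_pairr blik W).
      by apply: eq_Rintegral => x _; ring.
    have /andP[p0 p1] := psi01 W.
    have -> : L W ^+ 2 + (-2 * L W + 1) = (L W - 1) ^+ 2 by ring.
    set u := L W - 1; rewrite (_ : L W = u + 1); last by rewrite subrK.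
    rewrite mulrDr mulr1 addrC lerD2l.
    apply: (@le_trans _ _ `|u|).
      rewrite (le_trans (ler_norm _))// normrM ger0_norm// ler_piMl//.
    rewrite -(ler_pM2l (_ : 0 < 4 * k)) ?mulr_gt0// mulrDr mulrA divff ?mul1r; last first.
      by rewrite gt_eqF// mulr_gt0.
    have := sqr_ge0 (`|u| - 2 * k); rewrite -[u ^+ 2]real_normK ?num_real//; nra.
rewrite bmeas_RintegralD//; last first.
  apply: bmeasD; first exact: bmeas_cst.
  apply: bmeasZ; apply: bmeasD; first exact: bmeasX.
  by apply: bmeasD; [exact: bmeasZ|exact: bmeas_cst].
rewrite -addrA lerD2l bmeas_RintegralD; last 2 first.
- exact: bmeas_cst.
- apply: bmeasZ; apply: bmeasD; first exact: bmeasX.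
  by apply: bmeasD; [exact: bmeasZ|exact: bmeas_cst].
rewrite Rintegral_prob_cst lerD2l bmeas_RintegralZ; last first.
  apply: bmeasD; first exact: bmeasX.
  by apply: bmeasD; [exact: bmeasZ|exact: bmeas_cst].
rewrite mulrC ler_wpM2r ?invr_ge0 ?mulr_ge0 ?(ltW k0)//.
rewrite bmeas_RintegralD; last 2 first.
- exact: bmeasX.
- by apply: bmeasD; [exact: bmeasZ|exact: bmeas_cst].
rewrite bmeas_RintegralD; last 2 first.
- exact: bmeasZ.
- exact: bmeas_cst.
rewrite bmeas_RintegralZ// Rintegral_prob_cst.
have h1 : \int[Q]_W L W ^+ 2 <= 1 + c * eps by exact: projection1_sqr_le.
have h2 : 1 - tail <= \int[Q]_W L W by exact: projection1_ge.
lra.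
Qed.

(** For fixed W the averaged correlation is the inner product of the unit tensor y(W)^(tensor d)
    with the tensor m of projected features. Using a b <= k a^2 + b^2 / (4k) in each coordinate
    leaves k + |m|^2 / (4k), free of the estimator. *)
Lemma estimator_le (y : T -> vec R n) (k : R) : 0 < k -> measurable_fun setT y ->
  (forall W, S (y W)) ->
  \int[P]_x \int[Q]_W (\1_S x * vdot x (y (plant x W)) ^+ d) <=
  k + eps / (4 * k) + tail.
Proof.
move=> k0 my yS.
pose g (p : vec R n * T) : R := \1_S p.1 * vdot p.1 (y p.2) ^+ d.
have g1 x W : S x -> `|g (x, W)| <= 1.
  move=> Sx; rewrite /g indicE/= mem_set// mul1r normrX exprn_ile1//.
  exact: overlap_le1.
have bg : bounded_measurable g.
  split.
    apply: measurable_funM; first exact: (measurableT_comp (proj1 bS) measurable_fst).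
    apply: measurable_funX; apply: measurable_vdot => //.
    exact: measurableT_comp my measurable_snd.
  exists 1 => -[x W]; have [/set_mem Sx|xS] := boolP (x \in S); first exact: g1.
  by rewrite /g indicE/= (negPf xS) mul0r normr0.
have := @Rintegral_planted_le g bg g1.
move=> /le_trans; apply; rewrite lerD2r.
pose f j x : R := \1_S x * tnth (rank1 d x) j.
pose m j : T -> R := projection lam del P (f j).
have bf j : bounded_measurable (f j).
  split.
    apply: measurable_funM; first exact: measurable_indic (@measurable_sphere R n).
    exact: measurableT_comp (measurable_tnth j) (@measurable_rank1 R d n).
  exists 1 => x; rewrite /f indicE; have [/set_mem Sx|_] := boolP (x \in S); last first.
    by rewrite mul0r normr0.
  rewrite mul1r tnth_mktuple normr_prod; apply: prodr_ile1 => i.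
  by rewrite normr_ge0 normr_tnth_le1.
have bm j : bounded_measurable (m j) by exact: bmeas_projection.
have bsum : bounded_measurable (fun W => \sum_j m j W ^+ 2).
  by apply: bmeas_sum => j; exact: bmeasX.
apply: (@le_trans _ _ (\int[Q]_W (k + (4 * k)^-1 * \sum_j m j W ^+ 2))).
  apply: bmeas_le_Rintegral.
  - apply: (bmeas_Rintegralr P Q (f := fun p : vec R n * T => \1_S p.1 * g (p.1, p.2) * lik (p.1, p.2))).
    apply: bmeasM; last by move: blik; congr bounded_measurable; apply/funext => -[].
    apply: bmeasM; first exact: bmeas_fst.
    by move: bg; congr bounded_measurable; apply/funext => -[].
  - by apply: bmeasD; [exact: bmeas_cst|exact: bmeasZ].
  - move=> W; pose z := rank1 d (y W).
    have zz : \sum_j tnth z j ^+ 2 = 1.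
      rewrite -[RHS](expr1n _ d) -(yS W) -vdot_rank1.
      by apply: eq_bigr => j _; rewrite expr2.
    have -> : \int[P]_x (\1_S x * g (x, W) * lik (x, W)) = \sum_j tnth z j * m j W.
      transitivity (\int[P]_x \sum_j tnth z j * (f j x * lik (x, W))).
        apply: eq_Rintegral => x _; rewrite /g/= -vdot_rank1.
        rewrite mulrA -expr2 indicX mulrAC mulr_sumr; apply: eq_bigr => j _.
        by rewrite /f -/z; ring.
      have bfl j : bounded_measurable (fun x => f j x * lik (x, W)).
        by apply: bmeasM => //; exact: (bmeas_pairr blik W).
      rewrite bmeas_Rintegral_sum; last by move=> j; exact: bmeasZ.
      by apply: eq_bigr => j _; rewrite bmeas_RintegralZ.
    have kE : k = \sum_j k * tnth z j ^+ 2 by rewrite -mulr_sumr zz mulr1.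
    rewrite [X in _ <= X + _]kE [X in _ <= _ + X]mulr_sumr -big_split/=; apply: ler_sum => j _.
    set a := tnth z j; set b := m j W.
    rewrite -(ler_pM2l (_ : 0 < 4 * k)) ?mulr_gt0// mulrDr [X in _ <= _ + X]mulrA divff ?mul1r; last first.
      by rewrite gt_eqF// mulr_gt0.
    have := sqr_ge0 (2 * k * a - b); nra.
rewrite bmeas_RintegralD; last 2 first.
- exact: bmeas_cst.
- exact: bmeasZ.
rewrite Rintegral_prob_cst lerD2l bmeas_RintegralZ// mulrC.
rewrite ler_wpM2r ?invr_ge0 ?mulr_ge0 ?(ltW k0)//.
exact: projection_feature_sqr_le.
Qed.

End planted_versus_null.

(** * Return to the symmetrized model and conclusion *)

Lemma Rintegral_WT (R : realType) d n (h : tensor R d n -> R) :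
  bounded_measurable h ->
  \int[WT R d n]_W h W = \int[noise R d n]_W h (symmetrize W).
Proof.
move=> bh; congr fine; rewrite /WT integral_distribution//.
  by apply/measurable_EFinP; case: bh.
apply: (bmeas_integrable _ (f := h \o @symmetrize R d n)).
exact: (bmeas_comp bh (@measurable_symmetrize R d n)).
Qed.

Lemma Rintegral_spiked (R : realType) d n (P : probability (vec R n) R)
    (g : vec R n * tensor R d n -> R) : bounded_measurable g ->
  \int[(P \x WT R d n)%E]_p g p =
  \int[P]_x \int[noise R d n]_W g (x, symmetrize W).
Proof.
move=> bg; rewrite Rintegral_prod//; apply: eq_Rintegral => x _.
by rewrite (Rintegral_WT (bmeas_pairl bg x)).
Qed.

Lemma expR_tail_small (R : realType) (del e : R) : 0 < del -> 0 < e ->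
  exists n2 : nat, forall n, (n2 <= n)%N -> expR (- (n%:R * del ^+ 2 / 4)) <= e.
Proof.
move=> del0 e0; exists (Num.truncn (4 / (del ^+ 2 * e))).+1 => n hn.
have d2 : 0 < del ^+ 2 by rewrite exprn_gt0.
have h : 4 / (del ^+ 2 * e) < n%:R.
  by apply: lt_le_trans (truncnS_gt _) _; rewrite ler_nat.
move: h; rewrite ltr_pdivrMr ?mulr_gt0// => h.
set z := n%:R * del ^+ 2 / 4.
have hz : 1 < z * e by rewrite /z; lra.
rewrite -(ler_pM2r (expR_gt0 z)) -expRD addNr expR0.
have := expR_ge1Dx z; rewrite -(ler_pM2l e0); nra.
Qed.

Section main.
Variables (R : realType) (d : nat) (lam : R) (X : prior R).
Hypotheses (d3 : (3 <= d)%N) (sX : spherical_prior X).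
Hypotheses (lam0 : 0 <= lam) (lamlt : lam < lambda_sph R d).

Local Notation c del := (lam ^+ 2 / 2 + lam * del).

(** The value 0 is admissible, so the supremum is over a nonempty set. The strict gap l - lam is the
    room in which del is chosen. *)
Lemma admissible_gt : exists2 l, admissible d l & lam < l.
Proof.
have ne : [set l : R | admissible d l] !=set0.
  exists 0 => t /andP[t0 t1]; rewrite expr0n/= !mul0r oppr_ge0.
  by rewrite mulr_ge0_le0 ?invr_ge0// ln_le0// gerBl sqr_ge0.
by have [l hl ll] := sup_gt ne lamlt; exists l.
Qed.

Lemma c_ge0 del : 0 <= del -> 0 <= c del.
Proof. by move=> del0; rewrite addr_ge0 ?divr_ge0 ?sqr_ge0 ?mulr_ge0. Qed.

Lemma small_overlaps : exists2 del : R, 0 < del &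
  forall e, 0 < e -> exists n1 : nat, forall n, (n1 <= n)%N -> (0 < n)%N ->
  expR (- (n%:R * del ^+ 2 / 4)) <= e /\
  forall v : vec R n, vdot v v = 1 ->
  \int[X n]_x (overlap_weight n (c del) d (vdot x v) * \1_(@sphere R n) x) <= e.
Proof.
have [l adm ll] := admissible_gt.
(* Then l^2 / 2 = lam^2 / 2 + 2 lam del + 2 del^2, which exceeds lam^2 / 2 + lam del. *)
pose del := (l - lam) / 2.
have del0 : 0 < del by rewrite /del; lra.
have c0 : 0 <= c del by exact: c_ge0 (ltW del0).
have cl : c del < l ^+ 2 / 2.
  have lE : l = lam + 2 * del by rewrite /del; field.
  have h1 : 0 <= lam * del by rewrite mulr_ge0// ltW.
  have h2 : 0 < del ^+ 2 by rewrite exprn_gt0.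
  by rewrite lE; move: (del) h1 h2 => x h1 h2; nra.
exists del => // e e0.
have [n1 h1] := overlap_vanishes adm c0 cl e0.
have [n2 h2] := expR_tail_small del0 e0.
exists (maxn n1 n2) => n; rewrite geq_max => /andP[hn1 hn2] n0; split; first exact: h2.
by apply: h1 => //; exact: sX.
Qed.

Lemma no_weak_detection : ~ weak_detection d lam X.
Proof.
have [del del0 small] := small_overlaps.
move=> [eps eps0 [phi mphi [N0 _ hphi]]].
pose k := eps / 4.
have k0 : 0 < k by rewrite divr_gt0.
have c0 : 0 <= c del by exact: c_ge0 (ltW del0).
(* With tail <= e this makes (c e + 2 tail) / (4k) <= k / 4, so the planted and null acceptance
   probabilities differ by at most k + k / 4 + k < eps. *)
pose e := Num.min k (k ^+ 2 / (c del + 2)).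
have c2 : 0 < c del + 2 by move: c0; lra.
have e0 : 0 < e by rewrite lt_min k0 divr_gt0// exprn_gt0.
have ek : e <= k by rewrite ge_min lexx.
have ek2 : (c del + 2) * e <= k ^+ 2.
  by rewrite mulrC -ler_pdivlMr// ge_min lexx orbT.
have [n1 h] := small e e0.
pose n := maxn N0 (maxn n1 1).
have n0 : (0 < n)%N by rewrite /n !leq_max leqnn !orbT.
have [] := h n _ n0; first by rewrite /n !leq_max leqnn !orbT.
move=> ht ho.
have := hphi n; rewrite /= leq_maxl => /(_ isT); apply/negP; rewrite -ltNge.
pose A := [set T | phi n T].
have mA : measurable A.
  have -> : A = phi n @^-1` [set true] by [].
  by rewrite -[X in measurable X]setTI; exact: mphi.
have bA : bounded_measurable (\1_A : tensor R d n -> R) by exact: bmeas_indic.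
pose psi W : R := \1_A (symmetrize W).
have mpsi : measurable_fun setT psi.
  by case: (bmeas_comp bA (@measurable_symmetrize R d n)).
have psi01 W : 0 <= psi W <= 1.
  by rewrite /psi indicE; case: (_ \in _); rewrite ?ler01 ?lexx.
have bpsi : bounded_measurable psi.
  by split=> //; exists 1 => W; have /andP[p0 p1] := psi01 W; rewrite ger0_norm.
have nullE : WT R d n [set T | ~~ phi n T] = (1 - \int[noise R d n]_W psi W)%:E.
  have -> : [set T | ~~ phi n T] = ~` A.
    by apply/seteqP; split => T /= /negP.
  rewrite (probability_setC (WT R d n) mA) EFinB; congr (_ - _)%E.
  rewrite -(Rintegral_WT bA) EFin_Rintegral// integral_indic// setIT//.
have plantE : WT_spiked d n lam X [set T | phi n T] =
    (\int[X n]_x \int[noise R d n]_W psi (addv (scalev lam (rank1 d x)) W))%:E.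
  have bsp : bounded_measurable (fun p => \1_A (@spiked_sample R d n lam p) : R).
    exact: (bmeas_comp bA (@measurable_spiked_sample R d n lam)).
  transitivity ((\int[(X n \x WT R d n)%E]_p (\1_A (@spiked_sample R d n lam p)))%:E).
    rewrite EFin_Rintegral//.
    have := integral_indic (WT_spiked d n lam X) measurableT mA.
    rewrite setIT => <-; rewrite ge0_integral_distribution//.
    by apply/measurable_EFinP; case: bA.
  congr EFin; rewrite Rintegral_spiked//; apply: eq_Rintegral => x _.
  by apply: eq_Rintegral => W _; rewrite spiked_sample_symmetrize.
rewrite /test_success plantE nullE -!EFinM -EFinD lte_fin.
have := test_le d3 n0 lam0 (ltW del0) (sX n0) (ltW e0) ho k0 mpsi psi01.
set I := \int[X n]_x _; set J := \int[noise R d n]_W psi W => hI.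
have hq : (c del * e + 2 * expR (- (n%:R * del ^+ 2 / 4))) / (4 * k) <= k / 4.
  rewrite ler_pdivrMr ?mulr_gt0//.
  have : c del * e + 2 * expR (- (n%:R * del ^+ 2 / 4)) <= (c del + 2) * e by lra.
  lra.
rewrite /k in hq hI ht ek *; lra.
Qed.

Lemma no_weak_recovery : ~ weak_recovery d lam X.
Proof.
have [del del0 small] := small_overlaps.
move=> [eps eps0 [xhat mxhat [N0 _ hx]]].
pose k := eps / 4.
have k0 : 0 < k by rewrite divr_gt0.
(* Then k + e / (4k) + tail <= k + k / 4 + k < eps = 4k. *)
pose e := Num.min k (k ^+ 2).
have e0 : 0 < e by rewrite lt_min k0 exprn_gt0.
have ek : e <= k by rewrite ge_min lexx.
have ek2 : e <= k ^+ 2 by rewrite ge_min lexx orbT.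
have [n1 h] := small e e0.
pose n := maxn N0 (maxn n1 1).
have n0 : (0 < n)%N by rewrite /n !leq_max leqnn !orbT.
have [] := h n _ n0; first by rewrite /n !leq_max leqnn !orbT.
move=> ht ho.
have := hx n; rewrite /= leq_maxl => /(_ isT); apply/negP; rewrite -ltNge.
have [mx /(_ n0) ux] := mxhat n.
have Su T : sphere (xhat n T) by apply/vnorm1E.
pose y (W : tensor R d n) := xhat n (symmetrize W).
have my : measurable_fun setT y by exact: measurableT_comp (@measurable_symmetrize R d n).
have Sy W : sphere (y W) by exact: Su.
pose g (p : vec R n * tensor R d n) : R :=
  \1_(@sphere R n) p.1 * vdot p.1 (xhat n (spiked_sample lam p)) ^+ d.
have msp := @measurable_spiked_sample R d n lam.
have mv : measurable_fun setT (fun p : vec R n * tensor R d n =>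
    vdot p.1 (xhat n (spiked_sample lam p)) ^+ d).
  apply: measurable_funX; apply: measurable_vdot => //.
  exact: measurableT_comp mx msp.
have mS : measurable_fun setT (fun p : vec R n * tensor R d n => \1_(@sphere R n) p.1 : R).
  have mi : measurable_fun setT (\1_(@sphere R n) : vec R n -> R).
    exact: measurable_indic (@measurable_sphere R n).
  exact: (measurableT_comp mi measurable_fst).
have bg : bounded_measurable g.
  split; first exact: measurable_funM.
  exists 1 => p; rewrite /g indicE.
  have [/set_mem Sx|_] := boolP (_ \in _); last by rewrite mul0r normr0.
  by rewrite mul1r normrX exprn_ile1// overlap_le1.
rewrite unlock.
(* The correlation is unbounded off the sphere, so the indicator of the full-measure set sphere x
   tensors is inserted before passing to bounded integrands. *)
have -> : (\int[(X n \x WT R d n)%E]_p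
    ((vdot p.1 (xhat n (spiked_sample lam p)) ^+ d))%:E =
    \int[(X n \x WT R d n)%E]_p (g p)%:E)%E.
  have mST : measurable (@sphere R n `*` [set: tensor R d n]).
    by apply: measurableX => //; exact: measurable_sphere.
  have ST1 : (X n \x WT R d n)%E (@sphere R n `*` [set: tensor R d n]) = 1%E.
    rewrite product_measure1E//; last exact: measurable_sphere.
    by rewrite [X in (_ * X)%E](probability_setT (WT R d n)) mule1; exact: sphere_full (sX n0).
  rewrite (integral_full mST ST1 mv); apply: eq_integral => p _.
  rewrite /g mulrC; congr (_ * _)%:E; rewrite !indicE; congr (_%:R); congr nat_of_bool.
  by apply/idP/idP => /set_mem q; apply/mem_set; [case: q|split].
rewrite -EFin_Rintegral// lte_fin Rintegral_spiked//.
have := estimator_le d3 n0 lam0 (ltW del0) (sX n0) (ltW e0) ho k0 my Sy.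
set I := \int[X n]_x _; set J := \int[X n]_x _ => hI.
have -> : J = I.
  apply: eq_Rintegral => x _; apply: eq_Rintegral => W _.
  by rewrite /g spiked_sample_symmetrize.
have hq : e / (4 * k) <= k / 4 by rewrite ler_pdivrMr ?mulr_gt0//; lra.
rewrite /k in hq hI ht ek *; lra.
Qed.

End main.

Theorem theorem3p2 (R : realType) (d : nat) (lambda : R) (X : prior R) :
  (3 <= d)%N ->
  spherical_prior X ->
  0 <= lambda -> lambda < lambda_sph R d ->
  ~ weak_detection d lambda X /\ ~ weak_recovery d lambda X.
Proof.
move=> d3 sX l0 ll; split; first exact: no_weak_detection.
exact: no_weak_recovery.
Qed.
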